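(* Let $m\geq 3$ be a fixed integer, let $k\geq 4$ be an integer, and let $$A_m=\left\{n\geq m : R(\mathcal{C}_{n}^k,\mathcal{C}_{m}^k)=(k-1)n+\left\lfloor\frac{m-1}{2}\right\rfloor\right\}$$ (a set of integers $n$). If every integer $n$ with $m\leq n\leq 2m$ belongs to $A_m$, then $A_m$ is the set of all integers $n\geq m$.
   Context: For $k$-uniform hypergraphs $\mathcal{G},\mathcal{H}$, the Ramsey number $R(\mathcal{G},\mathcal{H})$ is the smallest integer $N$ such that every red-blue coloring of the edges of the complete $k$-uniform hypergraph $\mathcal{K}^k_N$ on $N$ vertices contains a red copy of $\mathcal{G}$ or a blue copy of $\mathcal{H}$ (copies are sub-hypergraphs, not necessarily induced). The $k$-uniform loose cycle $\mathcal{C}^k_n$ (cycle of length $n$) has vertex set $\{v_1,\ldots,v_{n(k-1)}\}$ and the $n$ edges $e_i=\{v_{(i-1)(k-1)+1},v_{(i-1)(k-1)+2},\ldots,v_{i(k-1)+1}\}$, $i=1,\ldots,n$, with subscripts taken mod $n(k-1)$. *)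

(* Defs.v *)
From mathcomp Require Import all_boot.

Set Implicit Arguments.
Unset Strict Implicit.
Unset Printing Implicit Defensive.

(* A hypergraph on the vertex type V is given by its edge set. *)
Definition hypergraph (V : finType) := {set {set V}}.

Definition uniform (V : finType) (k : nat) (G : hypergraph V) : Prop :=
  forall e, e \in G -> #|e| = k.

Definition complete (k N : nat) : hypergraph 'I_N :=
  [set e : {set 'I_N} | #|e| == k].

(* Not necessarily induced: other edges of H may lie inside the image. *)
Definition contains_copy (V W : finType) (G : hypergraph V) (H : hypergraph W)
    : Prop :=
  exists f : V -> W, injective f /\ forall e, e \in G -> f @: e \in H.

(* A red-blue coloring is a map c to bool, true meaning red; its values on sets
   that are not edges of the complete k-uniform hypergraph play no role. *)
Definition red_part (k N : nat) (c : {set 'I_N} -> bool) : hypergraph 'I_N :=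
  [set e : {set 'I_N} in complete k N | c e].

Definition blue_part (k N : nat) (c : {set 'I_N} -> bool) : hypergraph 'I_N :=
  [set e : {set 'I_N} in complete k N | ~~ c e].

Definition arrows (k N : nat) (V W : finType)
    (G : hypergraph V) (H : hypergraph W) : Prop :=
  forall c : {set 'I_N} -> bool,
    contains_copy G (red_part k c) \/ contains_copy H (blue_part k c).

(* R(G, H) = N, for k-uniform G and H; at most one N satisfies this. *)
Definition is_ramsey_number (k : nat) (V W : finType)
    (G : hypergraph V) (H : hypergraph W) (N : nat) : Prop :=
  arrows k N G H /\ forall M, arrows k M G H -> N <= M.

(* With vertices and edges both numbered from 0, the edge i consists of the k
   vertices i(k-1), i(k-1)+1, ..., (i+1)(k-1), taken modulo n(k-1). *)
Definition loose_edge (k n : nat) (i : 'I_n) : {set 'I_(n * (k - 1))} :=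
  [set v : 'I_(n * (k - 1)) |
    [exists j : 'I_k, val v == (i * (k - 1) + j) %% (n * (k - 1))]].

Definition loose_cycle (k n : nat) : hypergraph 'I_(n * (k - 1)) :=
  [set loose_edge k i | i : 'I_n].

Lemma loose_cycle_uniform (k n : nat) :
  1 < k -> 1 < n -> uniform k (loose_cycle k n).
Proof.
move=> k_gt1 n_gt1 e /imsetP[i _ ->].
have k1_gt0 : 0 < k - 1 by rewrite subn_gt0.
have lt_k : k <= n * (k - 1).
  apply: (@leq_trans (2 * (k - 1))); last by rewrite leq_mul2r n_gt1 orbT.
  by rewrite mul2n -addnn -{1}(subnK (ltnW k_gt1)) leq_add2l.
have N_gt0 : 0 < n * (k - 1) by apply: leq_trans lt_k; apply: ltnW.
pose g (j : 'I_k) := Ordinal (ltn_pmod (i * (k - 1) + j) N_gt0).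
have -> : loose_edge k i = g @: setT.
  apply/setP => v; rewrite inE; apply/existsP/imsetP => [[j /eqP vj]|[j _ ->]].
    by exists j => //; apply: val_inj.
  by exists j.
rewrite card_imset ?cardsT ?card_ord // => j1 j2 /(congr1 val) /= /eqP.
rewrite eqn_modDl !modn_small; first by move/eqP/val_inj.
- exact: leq_trans (ltn_ord _) lt_k.
- exact: leq_trans (ltn_ord _) lt_k.
Qed.

Definition A (k m n : nat) : Prop :=
  m <= n /\
  is_ramsey_number k (loose_cycle k n) (loose_cycle k m)
    ((k - 1) * n + (m - 1) %/ 2).

(* Main.v *)
Require Import Defs.
From mathcomp Require Import all_boot zify.

Set Implicit Arguments.
Unset Strict Implicit.
Unset Printing Implicit Defensive.

(** Lower bound.  Colour red the edges inside a fixed set of (k-1)n-1 vertices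
    and blue all the others.  A red loose cycle of length n does not fit in that
    set, and the (m-1)/2 vertices outside it cannot hit the m edges of a blue
    loose cycle, because a vertex lies on at most two of them
    ([arrows_lower]).

    Upper bound, by strong induction on n > 2m, with K = k-1 and no blue cycle of
    length m.  The case n = m gives a red cycle C of length m; the vertices off C
    are numerous enough for the case n-m, which gives a red cycle D of length
    n-m > m disjoint from C, and leaves a set W of (m-1)/2 vertices.  If there
    were no red cycle of length n, a blue cycle of length m would exist, as
    follows.

    Call joints the vertices common to two consecutive edges of C or of D, and
    centre a pair made of a joint of C and a joint of D.  Cut C and D open at an
    edge incident with the centre.  Two disjoint red edges which reconnect the
    two open paths crosswise would yield a red cycle of length n
    ([merge_cycles]): out of any two such edges one is blue.  Their K-1 vertices
    other than joints range freely over the two cut edges and W, and this freedom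
    forces many blue edges at each centre ([classification]): either one of C
    and D is full, meaning that from its two joints next to the centre one always
    has blue edges to the joint of the other cycle at the centre, through any
    prescribed vertex of W; or the centre is exceptional, and then both cycles
    have this property except for one vertex w0 of W, with an additional freedom
    inside the cut edges.

    The two blue edges of a full cycle, one on each side of the centre, meet in
    the joint of the other cycle only: they form a slot, a blue path of two edges
    that advances by two joints.  Slots at the successive centres (c, c'),
    (c+2, c'+2), ... are glued through their common joint when they run along the
    same cycle, and otherwise through a vertex of W, one for each slot
    ([chain]).  Since |W| = (m-1)/2, there are enough of these for the m/2 slots
    or so that a cycle of length m requires.

    It remains to start the chain with the right parity.  Suppose no centre is
    exceptional.  For odd m one edge which reaches the two frontiers at once is a
    start ([blue_odd]); for even m one needs two centres a knight move apart at
    which the same cycle is full, and these exist by inspection of a 7 by 7 grid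
    ([knight_pair], [blue_even]).  If some centre is exceptional, the additional
    freedom there gives the lengths 3 and 4 directly ([blue3], [blue4]) and
    starts of either parity for longer cycles ([start_odd], [start_even]), unless
    all of W, then of size two, is spent on two consecutive exceptional centres;
    in that case the lengths 5 and 6 are found at these two centres
    ([blue5_blue6]). *)

(** * Loose paths *)

Lemma cap1_mem (V : finType) (F U : {set V}) v : F :&: U = [set v] -> v \in F.
Proof. by move=> FU; move: (set11 v); rewrite -FU inE => /andP[]. Qed.

Section LoosePath.
Variables (V : finType) (H : hypergraph V).

(** Loose paths carry their vertex set instead of a list of vertices: gluing and
    closing them then only requires intersections of sets. *)
Inductive lpath : nat -> V -> V -> {set V} -> Prop :=
| lpath0 u : lpath 0 u u [set u]
| lpathS l u v w U F : lpath l u v U -> F \in H -> w \in F -> w != v ->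
    F :&: U = [set v] -> lpath l.+1 u w (U :|: F).

Lemma lpath_ends l u w U : lpath l u w U -> u \in U /\ w \in U.
Proof.
elim=> [v|{}l {}u v {}w {}U F _ [uU _] _ wF _ _]; first by rewrite set11.
by rewrite !inE uU wF orbT.
Qed.

Lemma lpath_cons l u v w U F : lpath l v w U -> F \in H -> u \in F -> u != v ->
  F :&: U = [set v] -> lpath l.+1 u w (F :|: U).
Proof.
move=> p FH uF; elim: p => {l w U} [v' uv FU|l v0 w' w U F' p IH F'H wF' ww' F'U uv FU].
  have vF := cap1_mem FU.
  have FE : [set u] :|: F = F :|: [set v'].
    by rewrite (setUidPr _) ?(setUidPl _) ?sub1set.
  rewrite -FE; apply: (@lpathS 0 u u) => //; first exact: lpath0.
    by rewrite eq_sym.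
  by apply/setIidPr; rewrite sub1set.
have [v0U w'U] := lpath_ends p.
have FU0 : F :&: U = [set v0].
  apply/eqP; rewrite eqEsubset sub1set inE v0U andbT; apply/andP; split.
    by rewrite -FU setIS ?subsetUl.
  exact: cap1_mem FU.
rewrite setUA; apply: (lpathS (IH uv FU0)) => //.
apply/setP => z; rewrite !inE; apply/andP/eqP => [[zF' /orP[zF|zU]]|->].
- have: z \in F :&: (U :|: F') by rewrite !inE zF zF' orbT.
  rewrite FU inE => /eqP zv; apply/set1P; rewrite -F'U inE zF' /=.
  by rewrite zv.
- by apply/set1P; rewrite -F'U inE zF'.
by rewrite w'U orbT (cap1_mem F'U).
Qed.

Lemma lpath_rev l u w U : lpath l u w U -> lpath l w u U.
Proof.
elim=> [v|{}l {}u v {}w {}U F _ IH FH wF wv FU]; first exact: lpath0.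
by rewrite setUC; apply: lpath_cons IH _ _ _ FU.
Qed.

Lemma lpath_cat l1 l2 u v w U1 U2 : lpath l1 u v U1 -> lpath l2 v w U2 ->
  U1 :&: U2 = [set v] -> lpath (l1 + l2) u w (U1 :|: U2).
Proof.
move=> p1 p2; elim: p2 p1 => {l2 v w U2}
    [v p1 _|l2 v v' w U2 F p2 IH FH wF wv FU p1 U12].
  by rewrite addn0 (setUidPl _) ?sub1set; last have [] := lpath_ends p1.
have [vU2 v'U2] := lpath_ends p2.
have [_ vU1] := lpath_ends p1.
rewrite addnS setUA.
have U1U2 : U1 :&: U2 = [set v].
  apply/eqP; rewrite eqEsubset sub1set inE vU1 vU2 andbT.
  by rewrite -U12 setIS ?subsetUl.
apply: (lpathS (IH p1 U1U2)) => //.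
apply/setP => z; rewrite !inE; apply/andP/eqP => [[zF /orP[zU|zU]]|->].
- have: z \in U1 :&: (U2 :|: F) by rewrite !inE zF zU orbT.
  by rewrite U12 inE => /eqP zv; apply/set1P; rewrite -FU inE zF zv.
- by apply/set1P; rewrite -FU inE zF zU.
by rewrite v'U2 orbT (cap1_mem FU).
Qed.

Variable k : nat.
Hypotheses (k_gt1 : 1 < k) (Hk : uniform k H).

(** Listing the vertices of each edge with its two joints at the ends lays the
    path out as a sequence in which the edges are the windows of width k starting
    at the multiples of k-1, which is the shape of [loose_edge]. *)
Lemma lpath_seq l u w U : lpath l u w U -> exists s : seq V,
  [/\ size s = l * (k - 1), uniq (rcons s w), rcons s w =i U,
      nth u (rcons s w) 0 = u &
      forall i, i < l ->
        [set nth u (rcons s w) (i * (k - 1) + j) | j : 'I_k] \in H].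
Proof.
elim=> [v|{}l {}u v {}w {}U F p [s [ss us sU s0 sH]] FH wF wv FU].
  exists [::]; split=> //= z; by rewrite !inE.
have vF := cap1_mem FU.
pose t := enum (F :\: [set v; w]).
have st : size t = k - 2.
  rewrite -cardE cardsD (Hk FH).
  by rewrite (setIidPr _) ?cards2 1?eq_sym ?wv // subUset !sub1set vF wF.
have szs : size (rcons s v) = l * (k - 1) + 1 by rewrite size_rcons ss addn1.
exists (rcons s v ++ t).
have tE z : z \in t = [&& z != v, z != w & z \in F].
  by rewrite mem_enum !inE negb_or andbA.
have FUz z : z \in F -> z \in U -> z = v.
  by move=> zF zU; apply/set1P; rewrite -FU inE zF.
have uniqs : uniq (rcons (rcons s v ++ t) w).
  rewrite rcons_uniq cat_uniq us enum_uniq andbT mem_cat sU tE eqxx /= andbF orbF.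
  apply/andP; split; first by apply: contraNN wv => /(FUz _ wF) ->.
  apply/hasPn => z; rewrite tE sU => /and3P[zv _ zF].
  by apply: contraNN zv => /(FUz _ zF) ->.
have szc : size (rcons s v ++ t) = l.+1 * (k - 1).
  rewrite size_cat szs st mulSn; lia.
split => //.
- move=> z; rewrite mem_rcons in_cons mem_cat sU tE !inE.
  case: (z =P w) => [->|_] /=; first by rewrite wF orbT.
  case: (z =P v) => [->|_] //=; have [_ ->] := lpath_ends p.
  by rewrite vF.
- by rewrite -cats1 -catA nth_cat szs addn1.
move=> i; rewrite ltnS leq_eqVlt => /orP[/eqP ->|il]; last first.
  suff -> : [set nth u (rcons (rcons s v ++ t) w) (i * (k - 1) + j) | j : 'I_k]
     = [set nth u (rcons s v) (i * (k - 1) + j) | j : 'I_k] by exact: sH.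
  apply: eq_imset => j; rewrite -cats1 -catA nth_cat szs ifT //.
  have := ltn_ord j; nia.
suff -> : [set nth u (rcons (rcons s v ++ t) w) (l * (k - 1) + j) | j : 'I_k] = F
  by [].
have nthE j : nth u (rcons (rcons s v ++ t) w) (l * (k - 1) + j) =
    nth u (v :: rcons t w) j.
  by rewrite -cats1 -!catA cats1 -!cats1 -!catA /= nth_cat ss ltnNge leq_addr /= addKn.
apply/setP => z.
have -> : z \in F = (z \in v :: rcons t w).
  rewrite in_cons mem_rcons in_cons tE.
  case: (z =P v) => [->|_] /=; first by rewrite vF.
  by case: (z =P w) => [->|_] //=; rewrite wF.
have szt : size (v :: rcons t w) = k by rewrite /= size_rcons st; lia.
apply/imsetP/idP => [[j _ ->]|zt].
  by rewrite nthE mem_nth // szt.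
have jk : index z (v :: rcons t w) < k by rewrite -szt index_mem.
by exists (Ordinal jk) => //; rewrite nthE /= -[LHS](nth_index u zt).
Qed.

(** The way to produce a loose cycle: the vertices that F adds to the path are
    put after those of the path, and the window of the last edge wraps around
    because indices are taken modulo the total number of vertices. *)
Lemma lpath_close l u w U F : lpath l u w U -> F \in H -> u != w ->
  F :&: U = [set u; w] -> contains_copy (@loose_cycle k l.+1) H.
Proof.
move=> p FH uw FU.
have [s [ss us sU s0 sH]] := lpath_seq p.
have l_gt0 : 0 < l.
  by case: p uw {FU ss us sU s0 sH} => // u0; rewrite eqxx.
have /setIP[uF _] : u \in F :&: U by rewrite FU !inE eqxx.
have /setIP[wF _] : w \in F :&: U by rewrite FU !inE eqxx orbT.
pose t := enum (F :\: [set u; w]).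
have st : size t = k - 2.
  rewrite -cardE cardsD (Hk FH).
  by rewrite (setIidPr _) ?cards2 ?uw // subUset !sub1set uF wF.
have tE z : z \in t = [&& z != u, z != w & z \in F].
  by rewrite mem_enum !inE negb_or andbA.
have szs : size (rcons s w) = l * (k - 1) + 1 by rewrite size_rcons ss addn1.
pose s' := rcons s w ++ t.
have szs' : size s' = l.+1 * (k - 1).
  rewrite size_cat szs st mulSn; lia.
have us' : uniq s'.
  rewrite cat_uniq us enum_uniq andbT /=; apply/hasPn => z.
  rewrite tE sU => /and3P[zu zw zF]; apply/negP => zU.
  have: z \in F :&: U by rewrite inE zF.
  by rewrite FU !inE (negPf zu) (negPf zw).
exists (fun i : 'I_(l.+1 * (k - 1)) => nth u s' i); split.
  move=> i j /eqP; rewrite nth_uniq ?szs' ?ltn_ord //.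
  by move/eqP/val_inj.
move=> e /imsetP[i _ ->].
have n_gt0 : 0 < l.+1 * (k - 1) by rewrite muln_gt0 /=; lia.
have -> : [set nth u s' (val x) | x in loose_edge k i] =
  [set nth u s' ((i * (k - 1) + j) %% (l.+1 * (k - 1))) | j : 'I_k].
  apply/setP => z; apply/imsetP/imsetP => [[x]|[j _ ->]].
    by rewrite inE => /existsP[j /eqP xj] ->; exists j => //; rewrite xj.
  exists (Ordinal (ltn_pmod (i * (k - 1) + j) n_gt0)) => //.
  by rewrite inE; apply/existsP; exists j.
have := ltn_ord i; rewrite ltnS leq_eqVlt => /orP[/eqP il|il].
  suff -> : [set nth u s' ((i * (k - 1) + j) %% (l.+1 * (k - 1))) | j : 'I_k] = F
    by [].
  have nthE (j : 'I_k) : nth u s' ((i * (k - 1) + j) %% (l.+1 * (k - 1))) =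
      nth u (w :: rcons t u) j.
    have /= jk := ltn_ord j.
    have [jk1|jk1] := ltnP j (k - 1).
      rewrite modn_small ?il; last by rewrite mulSn; lia.
      rewrite /s' -cats1 -catA nth_cat ss ltnNge leq_addr /= addKn.
      case: (nat_of_ord j) jk1 => //= j' jk1.
      by rewrite nth_rcons st ifT //; lia.
    have -> : val j = k - 1 by rewrite /=; lia.
    have -> : i * (k - 1) + (k - 1) = l.+1 * (k - 1) by rewrite il mulSn addnC.
    rewrite modnn nth_cat szs ifT ?addn1 // s0.
    have -> : k - 1 = (k - 2).+1 by lia.
    by rewrite /= nth_rcons st ltnn eqxx.
  apply/setP => z.
  have -> : z \in F = (z \in w :: rcons t u).
    rewrite in_cons mem_rcons in_cons tE.
    case: (z =P w) => [->|_] /=; first by rewrite wF.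
    by case: (z =P u) => [->|_] //=; rewrite uF.
  have szt : size (w :: rcons t u) = k by rewrite /= size_rcons st; lia.
  apply/imsetP/idP => [[j _ ->]|zt].
    by rewrite nthE mem_nth // szt.
  have jk : index z (w :: rcons t u) < k by rewrite -szt index_mem.
  by exists (Ordinal jk) => //; rewrite nthE /= -[LHS](nth_index u zt).
suff -> : [set nth u s' ((i * (k - 1) + j) %% (l.+1 * (k - 1))) | j : 'I_k] =
   [set nth u (rcons s w) (i * (k - 1) + j) | j : 'I_k] by exact: sH.
apply: eq_imset => j; have /= jk := ltn_ord j.
have lt1 : i * (k - 1) + j < l * (k - 1) + 1 by nia.
rewrite modn_small; last by rewrite mulSn; nia.
by rewrite nth_cat szs lt1.
Qed.

End LoosePath.

(** * Loose cycles as periodic walks *)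
Section Seg.
Variables (V : finType) (v : nat -> V).

Definition seg (a b : nat) : {set V} := [set z in [seq v s | s <- index_iota a b]].

Lemma segP a b z : reflect (exists2 s, a <= s < b & z = v s) (z \in seg a b).
Proof.
rewrite inE; apply: (iffP mapP) => [[s]|[s sab ->]].
  by rewrite mem_index_iota; exists s.
by exists s; rewrite ?mem_index_iota.
Qed.

Lemma mem_seg a b s : a <= s < b -> v s \in seg a b.
Proof. by move=> sab; apply/segP; exists s. Qed.

End Seg.

(** Numbering the vertices of a cycle by all natural numbers, periodically, avoids
    reductions modulo the length when moving along the cycle. *)
Lemma loose_cycle_walk (k n : nat) (V : finType) (H : hypergraph V)
    (f : 'I_(n * (k - 1)) -> V) : 0 < n -> 1 < k -> injective f ->
    (forall e, e \in loose_cycle k n -> f @: e \in H) ->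
  exists v : nat -> V,
    [/\ forall s s', v s = v s' <-> s = s' %[mod n * (k - 1)],
        forall i, seg v (i * (k - 1)) (i.+1 * (k - 1)).+1 \in H &
        forall s, v s \in [set f x | x : 'I_(n * (k - 1))]].
Proof.
move=> n_gt0 k_gt1 f_inj fH.
have N_gt0 : 0 < n * (k - 1) by rewrite muln_gt0 n_gt0; lia.
pose o s := Ordinal (ltn_pmod s N_gt0).
exists (fun s => f (o s)); split; last by move=> s; apply/imsetP; exists (o s).
  move=> s s'; split => [/f_inj/(congr1 val)//|ss'].
  by congr f; apply: val_inj.
move=> i.
suff -> : seg (fun s => f (o s)) (i * (k - 1)) (i.+1 * (k - 1)).+1 =
    f @: loose_edge k (Ordinal (ltn_pmod i n_gt0)).
  by apply: fH; apply: imset_f.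
have oE j : (i %% n * (k - 1) + j) %% (n * (k - 1)) = (i * (k - 1) + j) %% (n * (k - 1)).
  by rewrite -(modnMDl (i %/ n)) mulnA addnA -mulnDl -divn_eq.
apply/setP => z; apply/segP/imsetP => [[s si ->]|[x]].
  exists (o s) => //; rewrite inE.
  have sk : s - i * (k - 1) < k by move: si; rewrite mulSn; lia.
  apply/existsP; exists (Ordinal sk); rewrite oE /=; apply/eqP; congr modn.
  by lia.
rewrite inE => /existsP[j /eqP xj] ->.
exists (i * (k - 1) + j); first by have := ltn_ord j; rewrite mulSn; lia.
by congr f; apply: val_inj; rewrite xj /= oE.
Qed.

Lemma set_between (V : finType) (A Z : {set V}) n : #|Z| <= n <= #|A| ->
  exists S : {set V}, [/\ Z \subset S, S \subset A :|: Z & #|S| = n].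
Proof.
case/andP=> Zn nA; pose t := take (n - #|Z|) (enum (A :\: Z)).
have tE z : z \in t -> (z \notin Z) && (z \in A).
  by move/mem_take; rewrite mem_enum inE.
have sizet : size t = n - #|Z|.
  rewrite size_takel // -cardE cardsD; have := subset_leq_card (subsetIr A Z).
  lia.
exists (Z :|: [set z in t]); split; first exact: subsetUl.
  apply/subsetP => z; rewrite !inE => /orP[->|/tE/andP[_ ->] //]; exact: orbT.
rewrite cardsU (_ : Z :&: _ = set0) ?cards0; last first.
  by apply/setP => z; rewrite !inE; apply/negP => /andP[zZ /tE]; rewrite zZ.
have /card_uniqP : uniq t by rewrite take_uniq ?enum_uniq.
rewrite cardsE sizet => ->; lia.
Qed.

Lemma contains_copy_dec (V W : finType) (G : hypergraph V) (H : hypergraph W) :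
  contains_copy G H \/ ~ contains_copy G H.
Proof.
have [ex|nex] := boolP [exists f : {ffun V -> W}, injectiveb f &&
                         [forall e in G, f @: e \in H]].
  have /existsP[f /andP[/injectiveP fi /forall_inP fe]] := ex.
  by left; exists f.
right=> -[f [fi fe]]; case/negP: nex; apply/existsP; exists [ffun x => f x].
apply/andP; split; first by apply/injectiveP => x y; rewrite !ffunE => /fi.
apply/forall_inP => e /fe; congr (_ \in H); apply: eq_imset => x.
by rewrite ffunE.
Qed.

(* Linear arithmetic, restricted to the numerical facts of the context. *)
Ltac arith := repeat match goal with
  | H : is_true (_ \in _) |- _ => clear H
  | H : is_true (~~ (_ \in _)) |- _ => clear H
  | H : is_true (_ \subset _) |- _ => clear H
  | H : _ \/ _ |- _ => clear H
  | H : _ /\ _ |- _ => clear H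
  | H : or3 _ _ _ |- _ => clear H
  | H : or4 _ _ _ _ |- _ => clear H
  | H : forall x, _ |- _ => clear H
  | H : ~ _ |- _ => clear H
  | H : @eq ?A _ _ |- _ =>
      lazymatch A with nat => fail | bool => fail | _ => clear H end
  end; lia.

(** * Merging two disjoint red cycles *)

(** The walks [v true] and [v false] follow the two red cycles, of [len true] and
    [len false] edges of K+1 vertices; the joints are the vertices of index a
    multiple of K.  The set W holds the leftover vertices, and B the blue
    edges. *)
Section TwoRedCycles.
Variables (V : finType) (K : nat) (v : bool -> nat -> V) (len : bool -> nat).
Variables (W : {set V}) (B : hypergraph V).
Hypothesis K_gt2 : 2 < K.
Hypothesis vE : forall T s s', v T s = v T s' <-> s = s' %[mod len T * K].
Hypothesis v_neq : forall T s s', v T s != v (~~ T) s'.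
Hypothesis vW : forall T s, v T s \notin W.
Hypothesis len_gt2 : forall T, 2 < len T.
Let K_gt1 : 1 < K := ltnW K_gt2.

(** The edge incident with the joint i that follows it ([d] true) or precedes it
    runs from the joint [low d i] to the next one; [far d i] is its end other
    than i, and [inner] the set of its vertices that are not joints.  A centre is
    a function [c], giving a joint [c T] on each cycle T.  The edge [cross T d c S]
    crosses from the neighbour of the centre on T, on the side d, to the centre on
    the other cycle. *)
Definition far (d : bool) (i : nat) := if d then i.+1 else i.-1.
Definition low (d : bool) (i : nat) := if d then i else i.-1.
Definition inner T d i := seg (v T) (low d i * K).+1 ((low d i).+1 * K).
Definition cross T d (c : bool -> nat) (S : {set V}) :=
  v T (far d (c T) * K) |: (v (~~ T) (c (~~ T) * K) |: S).

Lemma v_inj T a s s' : a <= s < a + len T * K -> a <= s' < a + len T * K ->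
  v T s = v T s' -> s = s'.
Proof.
move=> sa s'a /vE.
have -> : s = (s - a) + a by lia.
have -> : s' = (s' - a) + a by lia.
by move=> /eqP; rewrite eqn_modDr !modn_small; try lia; move/eqP => ->.
Qed.

Lemma v_per T s i : v T (s + i * (len T * K)) = v T s.
Proof. by apply/vE; rewrite addnC modnMDl. Qed.

Lemma v_perK T i : v T ((i + len T) * K) = v T (i * K).
Proof. by rewrite mulnDl -[len T * K]mul1n v_per. Qed.

Lemma len_K T : 3 * K <= len T * K.
Proof. by rewrite leq_mul2r len_gt2 orbT. Qed.

Lemma card_inner T d i : #|inner T d i| = K - 1.
Proof.
rewrite /inner; set a := low d i.
have u : uniq [seq v T s | s <- index_iota (a * K).+1 (a.+1 * K)].
  rewrite map_inj_in_uniq ?iota_uniq // => s s'; rewrite !mem_index_iota => sa s'a.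
  by have := len_K T => lK; apply: (@v_inj T (a * K)); lia.
by rewrite /seg cardsE (card_uniqP u) size_map size_iota mulSn; lia.
Qed.

Lemma card_cross T d e (c : bool -> nat) (S : {set V}) :
  S \subset inner T d (c T) :|: inner (~~ T) e (c (~~ T)) :|: W -> 0 < c (~~ T) ->
  0 < c T -> #|S| = K - 1 -> #|cross T d c S| = K.+1.
Proof.
move=> sS cF_gt0 cT_gt0 cS.
have innl T' d' i : 0 < i -> v T' (far d' i * K) \notin inner T' d' i.
  move=> i0; have lT' := len_K T'; apply/negP => /segP[s si E].
  case: d' si E => /= si E; last rewrite (prednK i0) in si.
    have := @v_inj T' (i * K) _ _ _ _ E; have := mulSn i K; lia.
  have := prednK i0; move: (i.-1) si E => q si E qi; rewrite -qi in si *.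
  have := @v_inj T' (q * K) _ _ _ _ E; have := mulSn q K; lia.
have innc T' d' i : 0 < i -> v T' (i * K) \notin inner T' d' i.
  move=> i0; have lT' := len_K T'; apply/negP => /segP[s si E].
  case: d' si E => /= si E.
    have := @v_inj T' (i * K) _ _ _ _ E; have := mulSn i K; lia.
  move: si; have := prednK i0; move: (i.-1) => q qi; rewrite -qi in E * => si.
  have := @v_inj T' (q * K) _ _ _ _ E; have := mulSn q K; lia.
have nS z : z \in S -> [\/ z \in inner T d (c T), z \in inner (~~ T) e (c (~~ T)) | z \in W].
  move=> /(subsetP sS); rewrite !in_setU => /orP[/orP[]|]; by [constructor 1|constructor 2|constructor 3].
have h1 : v T (far d (c T) * K) \notin S.
  apply/negP => /nS[|/segP[s _ E]|]; [exact/negP/innl| |exact/negP/vW].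
  by have := v_neq T (far d (c T) * K) s; rewrite E eqxx.
have h2 : v (~~ T) (c (~~ T) * K) \notin S.
  apply/negP => /nS[/segP[s _ E]| |]; [|exact/negP/innc|exact/negP/vW].
  by have := v_neq T s (c (~~ T) * K); rewrite E eqxx.
rewrite /cross cardsU1 in_setU1 negb_or v_neq h1 cardsU1 h2 cS; lia.
Qed.

Section Arc.
Variable (H : hypergraph V).
Hypothesis vH : forall T i, seg (v T) (i * K) (i.+1 * K).+1 \in H.

Lemma walk_lpath T i l : l < len T ->
  lpath H l (v T (i * K)) (v T ((i + l) * K)) (seg (v T) (i * K) ((i + l) * K).+1).
Proof.
elim: l => [|l IH] ll.
  rewrite addn0; suff -> : seg (v T) (i * K) (i * K).+1 = [set v T (i * K)].
    exact: lpath0.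
  apply/setP => z; rewrite inE; apply/segP/eqP => [[s si ->]|->].
    by congr (v T _); lia.
  by exists (i * K); rewrite ?leqnn.
have -> : seg (v T) (i * K) ((i + l.+1) * K).+1 =
    seg (v T) (i * K) ((i + l) * K).+1 :|: seg (v T) ((i + l) * K) ((i + l).+1 * K).+1.
  apply/setP => z; rewrite in_setU; apply/segP/orP => [[s si zs]|].
    have [sl|sl] := leqP s ((i + l) * K); [left|right]; apply/segP; exists s => //; nia.
  by case=> /segP[s si zs]; exists s => //; nia.
apply: (lpathS (IH (ltnW ll))); rewrite ?vH ?addnS ?mem_seg //; first by nia.
  apply/eqP => /(@v_inj T ((i + l) * K)) eqs.
  have := len_K T => lT.
  have /eqs : (i + l) * K <= (i + l).+1 * K < (i + l) * K + len T * K by lia.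
  have le : (i + l) * K <= (i + l) * K < (i + l) * K + len T * K by lia.
  by move=> /(_ le); lia.
have lT : (i + l).+2 * K <= i * K + len T * K by rewrite -mulnDl leq_mul2r; lia.
apply/setP => z; rewrite in_setI in_set1.
apply/andP/eqP => [[/segP[s sl ->] /segP[s' s'l]]|->].
  by move/(@v_inj T (i * K)) => ss'; congr (v T _); lia.
by rewrite !mem_seg //; lia.
Qed.

(** The red path left when one edge is removed from a cycle. *)
Lemma arc T d i : 0 < i -> exists U,
  [/\ lpath H (len T).-1 (v T (far d i * K)) (v T (i * K)) U,
      [disjoint U & inner T d i] & forall z, z \in U -> exists s, z = v T s].
Proof.
move=> i_gt0; have lT := len_gt2 T.
exists (seg (v T) ((low d i).+1 * K) (((low d i).+1 + (len T).-1) * K).+1); split.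
- have ll : (len T).-1 < len T by lia.
  have := walk_lpath (low d i).+1 ll.
  have -> : v T (((low d i).+1 + (len T).-1) * K) = v T (low d i * K).
    by rewrite -[RHS]v_perK; congr (v T (_ * K)); lia.
  by case: d => //= p; apply: lpath_rev; rewrite prednK // in p *.
- have e1 := mulSn (low d i) K.
  have e2 : ((low d i).+1 + (len T).-1) * K = low d i * K + len T * K.
    by rewrite -mulnDl; congr (_ * K); lia.
  apply/pred0Pn => -[z /andP[/= /segP[s si ->] /segP[s' s'i]]].
  move/(@v_inj T (low d i * K).+1) => ss'.
  by have : s = s' by [apply: ss'; lia]; lia.
by move=> z /segP[s _ ->]; exists s.
Qed.

Hypothesis Huni : uniform K.+1 H.

(** Remove from either cycle the edge incident with the centre on the chosen side.
    One crossing edge joins the far end of the first path to the central end of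
    the second, and the other does the converse: the result is a cycle, and as
    many edges are added as removed. *)
Lemma merge_cycles T d e c (S R : {set V}) :
  (forall T, 0 < c T) -> S \subset inner T d (c T) :|: inner (~~ T) e (c (~~ T)) :|: W ->
  R \subset inner T d (c T) :|: inner (~~ T) e (c (~~ T)) :|: W ->
  [disjoint S & R] -> cross T d c S \in H -> cross (~~ T) e c R \in H ->
  contains_copy (@loose_cycle K.+1 (len T + len (~~ T))) H.
Proof.
move=> c_gt0 sS sR SR HS HR.
have [U1 [p1 d1 r1]] := arc T d (c_gt0 T).
have [U2 [p2 d2 r2]] := arc (~~ T) e (c_gt0 (~~ T)).
have out (Z : {set V}) z : Z \subset inner T d (c T) :|: inner (~~ T) e (c (~~ T)) :|: W ->
    z \in Z -> (z \notin U1) && (z \notin U2).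
  move=> sZ /(subsetP sZ); rewrite !in_setU => /orP[/orP[]|] zi; apply/andP; split.
  - by rewrite (disjointFl d1).
  - apply/negP => /r2[s' E]; have /segP[s _ E'] := zi.
    by have := v_neq T s s'; rewrite -E -E' eqxx.
  - apply/negP => /r1[s' E]; have /segP[s _ E'] := zi.
    by have := v_neq T s' s; rewrite -E -E' eqxx.
  - by rewrite (disjointFl d2).
  - by apply/negP => /r1[s' E]; have := vW T s'; rewrite -E zi.
  - by apply/negP => /r2[s' E]; have := vW (~~ T) s'; rewrite -E zi.
have u12 z : z \in U1 -> z \notin U2.
  move=> /r1[s ->]; apply/negP => /r2[s' E].
  by have := v_neq T s s'; rewrite E eqxx.
have [xU1 cU1] := lpath_ends p1.
have [yU2 dU2] := lpath_ends p2.
move: HS HR; rewrite /cross negbK.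
set x := v T (far _ _ * K) in p1 xU1 *; set x' := v T (c T * K) in p1 cU1 *.
set y := v (~~ T) (far _ _ * K) in p2 yU2 *.
set y' := v (~~ T) (c (~~ T) * K) in p2 dU2 * => HS HR.
have nU2 z : z \in U2 -> z \notin U1 by apply: contraL => /u12.
have q1 : lpath H (len T).-1.+1 x y (U1 :|: (y |: (x' |: R))).
  apply: lpathS p1 HR _ _ _; first by rewrite !inE eqxx.
    by apply: contraTneq yU2 => ->; apply: u12.
  apply/setP => z; rewrite !inE; apply/andP/eqP => [[/or3P[/eqP->|/eqP->//|zR] zU]|->].
  - by case/negP: (nU2 _ yU2).
  - by case/andP: (out R z sR zR); rewrite zU.
  by rewrite eqxx cU1 orbT.
have q2 : lpath H ((len T).-1.+1 + (len (~~ T)).-1) x y'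
    (U1 :|: (y |: (x' |: R)) :|: U2).
  apply: lpath_cat q1 p2 _; apply/setP => z; rewrite !inE.
  apply/andP/eqP => [[/or4P[zU|/eqP->//|/eqP->|zR] zU2]|->].
  - by case/negP: (u12 _ zU).
  - by case/negP: (u12 _ cU1).
  - by case/andP: (out R z sR zR); rewrite zU2.
  by rewrite eqxx yU2 orbT.
have -> : len T + len (~~ T) = ((len T).-1.+1 + (len (~~ T)).-1).+1.
  by have := (len_gt2 T, len_gt2 (~~ T)); case; arith.
have k_gt1 : 1 < K.+1 by arith.
apply: (lpath_close k_gt1 Huni q2 HS).
  by apply: contraTneq dU2 => <-; apply: u12.
apply/setP => z; rewrite !inE; apply/andP/orP => [[]|].
  case/or3P=> [->|->|zS]; rewrite ?orbT; [by left|by right|].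
  case/andP: (out S z sS zS) => /negPf-> /negPf->; rewrite orbF /=.
  case/or3P => [/eqP zy|/eqP zx|zR].
  - by move: (out S z sS zS); rewrite zy yU2 andbF.
  - by move: (out S z sS zS); rewrite zx cU1.
  by move: (disjointFr SR zS); rewrite zR.
case=> /eqP->; first by rewrite eqxx xU1.
by rewrite eqxx dU2 !orbT.
Qed.

End Arc.

(** * Blue edges at a centre *)

(** With no red cycle of length [len true + len false], of two disjoint candidates
    for a merge at least one is blue. *)
Hypothesis Buni : uniform K.+1 B.
Hypothesis bmerge : forall T d e (c : bool -> nat) (S R : {set V}),
  (forall T, 0 < c T) ->
  S \subset inner T d (c T) :|: inner (~~ T) e (c (~~ T)) :|: W ->
  R \subset inner T d (c T) :|: inner (~~ T) e (c (~~ T)) :|: W ->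
  [disjoint S & R] -> #|S| = K - 1 -> #|R| = K - 1 ->
  (cross T d c S \in B) || (cross (~~ T) e c R \in B).

(** A blue crossing edge that contains Z and, apart from its two joints and Z, only
    vertices of the edge being cut.  Chains place Z at their links, so that edges
    at different centres meet only in prescribed vertices. *)
Definition avail T d (c : bool -> nat) (Z : {set V}) := exists F,
  [/\ F \in B, v T (far d (c T) * K) \in F, v (~~ T) (c (~~ T) * K) \in F,
      Z \subset F & F \subset [set v T (far d (c T) * K); v (~~ T) (c (~~ T) * K)]
                       :|: inner T d (c T) :|: Z].

Definition full T c := forall d, avail T d c set0 /\ forall w, w \in W -> avail T d c [set w].

(** At an exceptional centre both cycles provide blue edges, on both sides, with
    the following freedom: Z may use any leftover vertex other than w0, any vertex
    of the edge being cut, and one vertex z on a suitable edge of the other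
    cycle. *)
Definition exceptional w0 (c : bool -> nat) := w0 \in W /\
  exists (e : bool -> bool) (z : bool -> V),
    (forall T, z T \in inner T (e T) (c T)) /\
    forall T d (Z : {set V}), Z \subset inner T d (c T) :|: [set z (~~ T)] :|: (W :\ w0) ->
      #|Z| < K -> avail T d c Z.

Lemma inner_neq T d i z : z \in inner T d i -> forall e j, z \notin inner (~~ T) e j.
Proof.
move=> /segP[s _ ->] e j; apply/negP => /segP[s' _ E].
by have := v_neq T s s'; rewrite E eqxx.
Qed.

Lemma innerW T d i z : z \in inner T d i -> z \notin W.
Proof. by move=> /segP[s _ ->]. Qed.

Lemma W_inner T d i w : w \in W -> w \notin inner T d i.
Proof. by apply: contraL; apply: innerW. Qed.

Lemma cross_avail T d c S (Z : {set V}) : cross T d c S \in B -> Z \subset S -> S \subset inner T d (c T) :|: Z ->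
  avail T d c Z.
Proof.
move=> SB ZS SZ; exists (cross T d c S); split; rewrite ?SB //.
- by rewrite !inE eqxx.
- by rewrite !inE eqxx orbT.
- by apply: (subset_trans ZS); rewrite /cross setUA subsetUr.
by rewrite /cross setUA; apply: (subset_trans (setUS _ SZ)); rewrite setUA.
Qed.

Section Class.
Variable c : bool -> nat.
Hypothesis c_gt0 : forall T, 0 < c T.

Let ew T d w b := cross T d c (w |: inner T d (c T) :\ b).
Let redw T d w := [forall b in inner T d (c T), ew T d w b \notin B].
Let fullb T := [forall d, (cross T d c (inner T d (c T)) \in B) &&
                          [forall w in W, ~~ redw T d w]].

Lemma cinn T d : #|inner T d (c T)| = K - 1.
Proof. exact: card_inner T d (c T). Qed.

Lemma inn_ex T d : exists b, b \in inner T d (c T).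
Proof. by apply/set0Pn; rewrite -card_gt0 cinn subn_gt0. Qed.

Lemma card_ew T d w b : w \in W -> b \in inner T d (c T) ->
  #|w |: inner T d (c T) :\ b| = K - 1.
Proof.
move=> wW bi; rewrite cardsU1 in_setD1 (negPf (W_inner _ _ _ wW)) andbF.
by have := cardsD1 b (inner T d (c T)); rewrite bi cinn => ->.
Qed.

Lemma fullbP T : fullb T -> full T c.
Proof.
move=> /forallP fT d; have /andP[e0 /forall_inP ew1] := fT d; split.
  by apply: (cross_avail e0); rewrite ?sub0set ?setU0.
move=> w /ew1; rewrite negb_forall_in => /exists_inP[b bi]; rewrite negbK => eb.
apply: (cross_avail eb); first by rewrite sub1set setU11.
by rewrite setUC setSU // subsetDl.
Qed.

(** Call (T, d, w) bad if all the crossing edges of T on the side d that use w and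
    all but one of the inner vertices are red.  If the same w is bad for both
    cycles, each of these red edges makes blue every candidate of the other cycle
    disjoint from it, and w is the exceptional vertex.  Otherwise, if the first
    cycle is not full, it has a red edge of this form, or one through the inner
    vertices only, which makes blue the candidates of the second cycle avoiding
    w; and some candidate through w is blue as well since w is not bad for
    both. *)
Lemma classification : full true c \/ full false c \/ exists w0, exceptional w0 c.
Proof.
have [ex|nex] := boolP [exists d, exists e, [exists w in W, redw true d w && redw false e w]].
  right; right; have /existsP[d0 /existsP[d1 /exists_inP[w wW /andP[r0 r1]]]] := ex.
  pose e T := if T then d0 else d1; exists w; split => //; exists e.
  have r T : redw T (e T) w by case: T.
  have [z0 z0i] := inn_ex true (e true); have [z1 z1i] := inn_ex false (e false).
  pose z (T : bool) := if T then z0 else z1; exists z.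
  have zi T : z T \in inner T (e T) (c T) by case: T.
  split => // T d Z sZ cZ.
  have [|S [ZS SZ cS]] := @set_between _ (inner T d (c T)) Z (K - 1).
    by rewrite cinn leqnn andbT; arith.
  apply: (cross_avail _ ZS SZ).
  have sS : S \subset inner T d (c T) :|: [set z (~~ T)] :|: (W :\ w).
    by apply: (subset_trans SZ); rewrite subUset sZ -setUA subsetUl.
  (* This crossing edge is red by the choice of w, and disjoint from S, which contains
     neither w nor any vertex of the other cycle but z (~~ T). *)
  pose R := w |: inner (~~ T) (e (~~ T)) (c (~~ T)) :\ z (~~ T).
  have := forall_inP (r (~~ T)) _ (zi (~~ T)) => /negPf.
  have := @bmerge T d (e (~~ T)) c S R c_gt0; rewrite /ew -/R => bm nR.
  move: bm; rewrite nR orbF; apply => //.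
  - apply: (subset_trans sS); rewrite !subUset -!andbA; apply/and3P; split.
    + by rewrite -setUA subsetUl.
    + by rewrite sub1set !in_setU zi !orbT.
    by rewrite (subset_trans (subsetDl _ _)) ?subsetUr.
  - rewrite subUset sub1set !in_setU wW !orbT /=.
    rewrite (subset_trans (subsetDl _ _)) //.
    by rewrite -setUA setUCA subsetUl.
  - apply/pred0Pn => -[x /andP[/= /(subsetP sS)]].
    rewrite !in_setU !in_setD1 !in_set1 => /orP[/orP[]|].
    + move=> xi; rewrite (negPf (inner_neq xi _ _)) andbF orbF => /eqP xw.
      by have := innerW xi; rewrite xw wW.
    + move=> /eqP ->; rewrite eqxx /= orbF => /eqP zw.
      by have := innerW (zi (~~ T)); rewrite zw wW.
    case/andP=> /negPf-> xW /=; by rewrite (negPf (W_inner _ _ _ xW)) andbF.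
  by rewrite /R card_ew.
have nr d e w : w \in W -> redw true d w -> ~~ redw false e w.
  move=> wW r0; apply: contra nex => r1; apply/existsP; exists d.
  by apply/existsP; exists e; apply/exists_inP; exists w => //; rewrite r0.
have [f1|] := boolP (fullb true); first by left; apply: fullbP.
have ewsub T d w b : w \in W -> w |: inner T d (c T) :\ b \subset inner T d (c T) :|: W.
  by move=> wW; rewrite setUC subUset sub1set (subset_trans (subsetDl _ _)) ?subsetUl //=
     in_setU wW orbT.
rewrite negb_forall => /existsP[d]; rewrite negb_and negb_forall_in => /orP[e0|].
  right; left; apply: fullbP; apply/forallP => e.
  have bl (S : {set V}) : S \subset inner false e (c false) :|: W -> #|S| = K - 1 -> cross false e c S \in B.
    move=> sS cS; have := @bmerge true d e c (inner true d (c true)) S c_gt0.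
    rewrite (negPf e0); apply; rewrite ?cinn //.
    - by rewrite -setUA subsetUl.
    - by rewrite -setUA (subset_trans sS) ?subsetUr.
    apply/pred0Pn => -[x /andP[/= xi /(subsetP sS)]].
    by rewrite in_setU (negPf (inner_neq xi _ _)) (negPf (innerW xi)).
  rewrite bl ?subsetUl ?cinn //=; apply/forall_inP => w wW.
  have [b bi] := inn_ex false e; rewrite negb_forall_in; apply/exists_inP; exists b => //.
  by rewrite negbK /ew bl ?ewsub ?card_ew.
case/exists_inP => w wW; rewrite negbK => rw.
right; left; apply: fullbP; apply/forallP => e.
have [b bi] := inn_ex true d; have eb := forall_inP rw b bi.
have bl (S : {set V}) : S \subset inner false e (c false) :|: W -> w \notin S -> #|S| = K - 1 ->
    cross false e c S \in B.
  move=> sS wS cS; have := @bmerge true d e c (w |: inner true d (c true) :\ b) S c_gt0.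
  rewrite (negPf eb); apply; rewrite ?card_ew //.
  - by rewrite (subset_trans (ewsub _ _ _ _ wW)) // -setUA setUS ?subsetUr.
  - by rewrite -setUA (subset_trans sS) ?subsetUr.
  apply/pred0Pn => -[x /andP[/=]]; rewrite in_setU1 in_setD1 => /orP[/eqP->|].
    by rewrite (negPf wS).
  case/andP=> _ xi /(subsetP sS).
  by rewrite in_setU (negPf (inner_neq xi _ _)) (negPf (innerW xi)).
rewrite bl ?subsetUl ?cinn //=; last exact: W_inner.
apply/forall_inP => w' w'W; have [ww'|ww'] := eqVneq w w'.
  by apply: (nr d) => //; rewrite -ww'.
have [b' b'i] := inn_ex false e; rewrite negb_forall_in; apply/exists_inP; exists b' => //.
rewrite negbK /ew bl ?ewsub ?card_ew // in_setU1 in_setD1 (negPf ww') /=.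
by rewrite (negPf (W_inner _ _ _ wW)) andbF.
Qed.

End Class.

(** * Chains of slots *)

(** A blue path of l edges from A to v0 on the vertex set U, followed by a blue
    edge F whose exit is still to be chosen.  The frontier on the cycle T is the
    joint [i T].  The next [r.*2] edges of each cycle are unused, except perhaps
    for their end joints, and Y is a set of unused vertices kept for later links.
    All of A serves as a set of possible starting points because the cycle may have
    to close either through a vertex of W or through a joint. *)
Definition chain_state (A Y : {set V}) l (i : bool -> nat) r (U F : {set V}) v0 :=
  [/\ forall u, u \in A -> lpath B l u v0 U, F \in B, F :&: U = [set v0],
      forall T s, i T * K < s < (i T + r.*2) * K -> v T s \notin U :|: F &
      (forall T s, i T * K <= s < (i T + r.*2) * K -> v T s \notin Y) /\
      forall y, y \in Y -> y \notin U :|: F].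

(** The slot that starts from the frontier i is built at the next centre. *)
Definition centre (i : bool -> nat) (T : bool) := (i T).+1.

Lemma availP T d c Z : avail T d c Z -> exists F, [/\ F \in B, v T (far d (c T) * K) \in F,
  v (~~ T) (c (~~ T) * K) \in F, Z \subset F &
  forall z, z \in F -> [\/ z = v T (far d (c T) * K), z = v (~~ T) (c (~~ T) * K),
    (exists2 s, low d (c T) * K < s < (low d (c T)).+1 * K & z = v T s) | z \in Z]].
Proof.
case=> F [FB eF cF ZF sF]; exists F; split => // z /(subsetP sF).
rewrite 2!in_setU in_set2 => /orP[/orP[/orP[]|]|].
- by move/eqP; constructor 1.
- by move/eqP; constructor 2.
- by case/segP=> s si ->; constructor 3; exists s.
by constructor 4.
Qed.

Lemma vneq T s s' : v T s = v (~~ T) s' -> False.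
Proof. by move=> E; have := v_neq T s s'; rewrite E eqxx. Qed.

Lemma vinj T i s s' : i * K <= s < i.+3 * K -> i * K <= s' < i.+3 * K ->
  v T s = v T s' -> s = s'.
Proof.
have := len_K T => lK si s'i; apply: (@v_inj T (i * K)); arith.
Qed.

(** A slot along the cycle T: it is entered from F at the vertex q, which is either
    the frontier joint of T or a leftover vertex put in the first edge by Z1, and
    consists of the blue edges on the two sides of the centre, which share the
    joint of the other cycle. *)
Section Slot.
Variables (A Y : {set V}) (l : nat) (i : bool -> nat) (r : nat) (U F : {set V}) (v0 : V).
Variables (T : bool) (q : V) (Z1 Z2 : {set V}).
Hypothesis rlen : forall T, r.+1.*2 <= len T.
Hypothesis b : chain_state A Y l i r.+1 U F v0.
Hypotheses (qF : q \in F) (qU : q \notin U) (Z1q : Z1 \subset [set q]).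
Hypothesis q1 : q = v T (i T * K) \/ q \in Z1.
Hypothesis q2 : q = v T (i T * K) \/ v T (i T * K) \notin U :|: F.
Hypothesis av1 : avail T false (centre i) Z1.
Hypothesis av2 : avail T true (centre i) Z2.

Lemma slot_edges : exists F1 F2,
  [/\ F1 \in B, F2 \in B, Z2 \subset F2, v T ((i T).+2 * K) \in F2 &
  [/\ v (~~ T) ((i (~~ T)).+1 * K) \in F1, v (~~ T) ((i (~~ T)).+1 * K) \in F2,
   F1 :&: (U :|: F) = [set q],
   forall z, z \in F1 -> [\/ z = q, z = v (~~ T) ((i (~~ T)).+1 * K) |
      exists2 s, i T * K <= s < (i T).+1 * K & z = v T s] &
   forall z, z \in F2 -> [\/ z = v T ((i T).+2 * K), z = v (~~ T) ((i (~~ T)).+1 * K),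
     z \in Z2 | exists2 s, (i T).+1 * K < s < (i T).+2 * K & z = v T s]]].
Proof.
have [F1 [F1B eF1 cF1 Z1F sF1]] := availP av1.
have [F2 [F2B eF2 cF2 Z2F sF2]] := availP av2.
have [_ _ _ fresh _] := b.
exists F1, F2; split => //; split => //.
- apply/setP => z; rewrite in_setI in_set1.
  apply/andP/eqP => [[/sF1[->|->|[s si ->]|zZ] zUF]|->].
  + by case: q2 => // /negP.
  + by have /negP := fresh (~~ T) ((i (~~ T)).+1 * K) ltac:(arith).
  + by have /negP := fresh T s ltac:(rewrite /= in si; arith).
  + by apply/set1P; apply: (subsetP Z1q).
  split; last by rewrite inE qF orbT.
  by case: q1 => [->|/(subsetP Z1F)].
- move=> z /sF1[->|->|[s si ->]|/(subsetP Z1q)/set1P ->].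
  + by constructor 3; exists (i T * K) => //; arith.
  + by constructor 2.
  + by constructor 3; exists s => //; rewrite /= in si; arith.
  + by constructor 1.
move=> z /sF2[->|->|[s si ->]|zZ].
+ by constructor 1.
+ by constructor 2.
+ by constructor 4; exists s.
by constructor 3.
Qed.

Lemma slot_path F1 : F1 \in B -> v (~~ T) ((i (~~ T)).+1 * K) \in F1 ->
  F1 :&: (U :|: F) = [set q] -> forall u, u \in A ->
  lpath B l.+2 u (v (~~ T) ((i (~~ T)).+1 * K)) (U :|: F :|: F1).
Proof.
move=> F1B cF1 F1q u uA; have [p FB FU fresh _] := b.
have pu := p u uA.
have p1 : lpath B l.+1 u q (U :|: F).
  apply: (lpathS pu) => //; apply: contraNneq qU => ->.
  by have [] := lpath_ends pu.
apply: (lpathS p1) => //.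
apply/negP => /eqP E.
have /negP := fresh (~~ T) ((i (~~ T)).+1 * K) ltac:(arith); apply.
by rewrite E inE qF orbT.
Qed.

(** The second edge of the last slot returns to the start of the path, either at
    the joint of T two steps ahead, when the chain has gone all the way around, or
    at a leftover vertex. *)
Lemma slot_close u : r = 0 -> u \in A -> Z2 \subset [set u] ->
  u = v T ((i T).+2 * K) \/ u \in Z2 ->
  u = v T ((i T).+2 * K) \/ v T ((i T).+2 * K) \notin U :|: F ->
  contains_copy (@loose_cycle K.+1 l.+3) B.
Proof.
move=> r0 uA Z2u u1 u2.
have [F1 [F2 [F1B F2B Z2F eF2 [cF1 cF2 F1q sF1 sF2]]]] := slot_edges.
have [p FB FU fresh _] := b.
have [uU _] := lpath_ends (p u uA).
have P := slot_path F1B cF1 F1q uA.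
have uc : u != v (~~ T) ((i (~~ T)).+1 * K).
  apply: contraTneq uU => ->.
  by have := fresh (~~ T) ((i (~~ T)).+1 * K) ltac:(arith); rewrite inE negb_or => /andP[].
apply: (lpath_close _ Buni P F2B uc); first by arith.
apply/setP => z; rewrite !inE; apply/andP/orP => [[]|[]/eqP->]; last 2 first.
- split; last by rewrite uU.
  by case: u1 => [->//|/(subsetP Z2F)].
- by rewrite cF2 cF1 !orbT.
move=> /sF2[->|->|/(subsetP Z2u)/set1P ->|[s si ->]]; rewrite ?eqxx; [| by right | by left |].
- case/orP=> [h|/sF1].
    by case: u2 => [->|]; [left; rewrite eqxx | rewrite inE h].
  case=> [E|/vneq//|[s si /(@vinj T (i T))]].
    have : q \in U :|: F by rewrite inE qF orbT.
    by case: u2 => [->|]; [left; rewrite eqxx | rewrite E => /negP].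
  by move=> E; have := E ltac:(arith) ltac:(arith); arith.
case/orP=> [h|/sF1].
  by have := fresh T s ltac:(arith); rewrite inE h.
case=> [E|/vneq//|[s' si' /(@vinj T (i T))]].
  by have := fresh T s ltac:(arith); rewrite E inE qF orbT.
by move=> E; have := E ltac:(arith) ltac:(arith); arith.
Qed.

(** The second edge F' of a slot always contains an unused leftover vertex w as well
    as the next frontier joint of T.  Its exit is left open: the next slot starts
    from the joint if it is along T, and from w otherwise. *)
Lemma slot_step w : 0 < r -> w \in W -> w \in Y -> Z2 = [set w] ->
  exists U' F' v0', [/\ chain_state A (Y :\ w) l.+2 (fun T => (i T).+2) r U' F' v0',
    v T ((i T).+2 * K) \in F', v T ((i T).+2 * K) \notin U',
    w \in F' /\ w \notin U' & v (~~ T) ((i (~~ T)).+2 * K) \notin U' :|: F'].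
Proof.
move=> r0 wW wY Z2E.
have [F1 [F2 [F1B F2B Z2F eF2 [cF1 cF2 F1q sF1 sF2]]]] := slot_edges.
have [p FB FU fresh [vY Yfresh]] := b.
have qUF : q \in U :|: F by rewrite inE qF orbT.
have wq : w <> q by move=> E; have := Yfresh w wY; rewrite E qUF.
have wv T' s : w <> v T' s by move=> E; have := vW T' s; rewrite -E wW.
have frT T' s : i T' * K < s < (i T' + r.+1.*2) * K -> v T' s \in U :|: F -> False.
  by move=> /fresh/negP.
have hr : (i T).+3 * K <= (i T + r.+1.*2) * K by rewrite leq_mul2r; arith.
have hr' : (i (~~ T)).+3 * K <= (i (~~ T) + r.+1.*2) * K by rewrite leq_mul2r; arith.
have same T1 T2 s1 s2 : v T1 s1 = v T2 s2 ->
    i T1 * K <= s1 < (i T1 + r.+1.*2) * K -> i T2 * K <= s2 < (i T2 + r.+1.*2) * K ->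
    T1 = T2 /\ s1 = s2.
  case: (T1 =P T2) => [<-|ne E _ _]; last first.
    by exfalso; move: E; case: T1 T2 ne => [] [] // _ /esym; apply: vneq.
  move=> E h1 h2; split => //; have lr : r.+1.*2 * K <= len T1 * K by rewrite leq_mul2r rlen orbT.
  by apply: (@v_inj T1 (i T1 * K)) E; arith.
have TnT : T <> ~~ T by case: (T).
exists (U :|: F :|: F1), F2, (v (~~ T) ((i (~~ T)).+1 * K)).
have F2UF z : z \in F2 -> z \in U :|: F -> False.
  move=> /sF2[->|->||[s si ->]]; try by apply: frT; arith.
  by rewrite Z2E => /set1P -> ; apply/negP/Yfresh.
split.
- split => //.
  + by move=> u uA; apply: slot_path.
  + apply/setP => z; rewrite in_setI in_setU in_set1; apply/andP/eqP => [[zF2]|->]; last first.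
      by rewrite cF2 cF1 orbT.
    case/orP=> [/(F2UF _ zF2)//|/sF1[E|//|[s si E]]].
      by case: (F2UF _ zF2); rewrite E.
    move: zF2; rewrite E => /sF2[|/vneq//||[s' s'i]].
    * by move/(@vinj T (i T)) => /(_ ltac:(arith) ltac:(arith)); arith.
    * by rewrite Z2E => /set1P/esym/wv.
    * by move/(@vinj T (i T)) => /(_ ltac:(arith) ltac:(arith)); arith.
  + move=> T0 s si; have si' : i T0 * K < s < (i T0 + r.+1.*2) * K by arith.
    rewrite in_setU in_setU; apply/negP => /orP[/orP[|]|].
    * exact: frT.
    * move=> /sF1[E|E|[s' s'i E]].
      - by apply: (frT _ _ si'); rewrite E.
      - by have [T0E sE] := same _ _ _ _ E ltac:(arith) ltac:(arith); subst; arith.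
      - by have [T0E sE] := same _ _ _ _ E ltac:(arith) ltac:(arith); subst; arith.
    move=> /sF2[E|E||[s' s'i E]].
    * by have [T0E sE] := same _ _ _ _ E ltac:(arith) ltac:(arith); subst; arith.
    * by have [T0E sE] := same _ _ _ _ E ltac:(arith) ltac:(arith); subst; arith.
    * by rewrite Z2E => /set1P/esym/wv.
    * by have [T0E sE] := same _ _ _ _ E ltac:(arith) ltac:(arith); subst; arith.
  + split=> [T0 s si|y].
      by rewrite in_setD1 negb_and vY ?orbT //; arith.
    rewrite in_setD1 => /andP[/eqP yw yY].
    have yv T0 s : i T0 * K <= s < (i T0 + r.+1.*2) * K -> y <> v T0 s.
      by move=> si E; have := vY _ _ si; rewrite -E yY.
    rewrite in_setU in_setU; apply/negP => /orP[/orP[|]|].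
    * exact/negP/Yfresh.
    * move=> /sF1[E|/yv|[s si /yv]]; [|apply; arith|apply; arith].
      by have := Yfresh y yY; rewrite E qUF.
    move=> /sF2[/yv|/yv||[s si /yv]]; try (by apply; arith).
    by rewrite Z2E => /set1P.
- by [].
- rewrite in_setU; apply/negP => /orP[/frT|/sF1[E|/vneq//|[s si E]]]; first by apply; arith.
    by have := fresh T ((i T).+2 * K) ltac:(arith); rewrite E qUF.
  by have [_ sE] := same _ _ _ _ E ltac:(arith) ltac:(arith); arith.
- split; first by apply: (subsetP Z2F); rewrite Z2E set11.
  rewrite in_setU; apply/negP => /orP[|/sF1[//|/wv//|[s si /wv//]]].
  exact/negP/Yfresh.
rewrite in_setU in_setU; apply/negP => /orP[/orP[/frT|/sF1[E|E|[s si E]]]|].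
- by apply; arith.
- by have := fresh (~~ T) ((i (~~ T)).+2 * K) ltac:(arith); rewrite E qUF.
- by have [_ sE] := same _ _ _ _ E ltac:(arith) ltac:(arith); arith.
- by have [/esym/TnT] := same _ _ _ _ E ltac:(arith) ltac:(arith).
move=> /sF2[E|E||[s si E]].
- by have [/esym/TnT] := same _ _ _ _ E ltac:(arith) ltac:(arith).
- by have [_ sE] := same _ _ _ _ E ltac:(arith) ltac:(arith); arith.
- by rewrite Z2E => /set1P/esym/wv.
by have [/esym/TnT] := same _ _ _ _ E ltac:(arith) ltac:(arith).
Qed.

End Slot.

(** The edges required by a slot along T: the second one contains w if the slot is
    followed by another one or closes the cycle at w, and no leftover vertex if it
    closes at a joint. *)
Definition slot_avail T c Z w := [/\ avail T false c Z, avail T true c [set w] & avail T true c set0].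

(** The centre supports a slot which uses the leftover vertex w: only the exceptional
    vertex has to be avoided. *)
Definition usable w c := full true c \/ full false c \/ exists w0, w0 <> w /\ exceptional w0 c.

Lemma full_slot T c w : full T c -> w \in W -> slot_avail T c set0 w.
Proof. by move=> f wW; split; [case: (f false)|case: (f true) => _; apply|case: (f true)]. Qed.

Lemma exceptional_slot T c w0 w : exceptional w0 c -> w0 <> w -> w \in W -> slot_avail T c set0 w.
Proof.
case=> _ [e [z [_ s]]] w0w wW.
split; apply: s; rewrite ?cards0 ?cards1 ?sub0set // 1?ltnW //.
by rewrite sub1set in_setU in_setD1 wW andbT; apply/orP; right; apply/eqP => /esym.
Qed.

(** T is the cycle of the preceding slot and wl the leftover vertex in its last
    edge. *)
Lemma usable_slot T c w wl : usable w c -> w \in W -> wl \in W ->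
  slot_avail T c set0 w \/ slot_avail (~~ T) c [set wl] w.
Proof.
move=> okw wW wlW.
have right_ : full (~~ T) c -> slot_avail T c set0 w \/ slot_avail (~~ T) c [set wl] w.
  move=> f; right; have [h1 h2 h3] := full_slot f wW; split => //.
  by case: (f false) => _; apply.
case: okw => [|[|[w0 [w0w s]]]]; last by left; apply: exceptional_slot s _ _.
  by case: T right_ => [_|h] f; [left; apply: full_slot|apply: h].
by case: T right_ => [h|_] f; [apply: h|left; apply: full_slot].
Qed.

(** The frontier after p slots, starting from b. *)
Definition front (b : bool -> nat) p (T : bool) := p.*2 + b T.

Lemma fresh_vertex (X Y : {set V}) r d : #|X| <= d -> r.+1 + d <= #|Y :&: W| ->
  exists2 w, w \in W & (w \in Y) && (w \notin X).
Proof.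
move=> Xd rY; have /card_gt0P[w] : 0 < #|(Y :&: W) :\: X|.
  by have := subset_leq_card (subsetIr (Y :&: W) X); rewrite cardsD; arith.
by rewrite !inE => /and3P[wX wY wW]; exists w => //; rewrite wY wX.
Qed.

(** The cycle is to be closed at wc, which is therefore reserved from the start, or
    at a joint in A; at each centre at most dl leftover vertices are forbidden. *)
Section ChainInd.
Variables (A : {set V}) (b : bool -> nat) (dl : nat) (wc : V).
Hypotheses (wcW : wc \in W) (wcA : wc \in A).

Lemma chain_last T (Z1 : {set V}) l i U F v0 Y q : chain_state A Y l i 1 U F v0 ->
  q \in F -> q \notin U -> Z1 \subset [set q] ->
  q = v T (i T * K) \/ q \in Z1 ->
  q = v T (i T * K) \/ v T (i T * K) \notin U :|: F ->
  slot_avail T (centre i) Z1 wc -> v T ((i T).+2 * K) \in Y :|: A ->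
  contains_copy (@loose_cycle K.+1 l.+3) B.
Proof.
move=> bs qF qU Z1q q1 q2 [a1 a2 a3].
have rlen T0 : 1.*2 <= len T0 by exact: ltnW (len_gt2 T0).
rewrite in_setU => /orP[lY|lA].
  have [_ _ _ _ [_ /(_ _ lY) lUF]] := bs.
  apply: (slot_close bs qF qU Z1q q1 q2 a1 a2 _ wcA) => //.
    by right; rewrite set11.
  by right.
by apply: (slot_close bs qF qU Z1q q1 q2 a1 a3 _ lA); rewrite ?sub0set //; left.
Qed.

(** Each slot uses up one leftover vertex, hence the bound on Y; the last one uses
    wc.  The cycle followed by each slot is dictated by the centre it is built at,
    and the last edge F of the path allows for both cases: it contains the frontier
    joint of T and the link wl to the other cycle. *)
Lemma chain r : forall p T l U F v0 Y wl,
  chain_state A Y l (front b p) r.+1 U F v0 ->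
  v T (front b p T * K) \in F -> v T (front b p T * K) \notin U ->
  wl \in F -> wl \notin U -> wl \in W -> v (~~ T) (front b p (~~ T) * K) \notin U :|: F ->
  (forall T, r.+1.*2 <= len T) -> (0 < r -> r + dl <= #|Y :&: W|) ->
  (forall j, j < r -> exists X : {set V}, #|X| <= dl /\
     forall w, w \in W -> w \notin X -> usable w (centre (front b (p + j)))) ->
  usable wc (centre (front b (p + r))) ->
  (forall T, v T (front b (p + r).+1 T * K) \in Y :|: A) ->
  contains_copy (@loose_cycle K.+1 (l + r.*2).+3) B.
Proof.
elim: r => [|r IH] p T l U F v0 Y wl bs xF xU wF wU wlW fUF rlen cY okp okr last.
  rewrite addn0 in okr last; rewrite addn0.
  have [av0|av0] := usable_slot T okr wcW wlW.
    by apply: (chain_last bs xF xU _ _ _ av0 (last T)); rewrite ?sub0set //; left.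
  apply: (chain_last bs wF wU _ _ _ av0 (last (~~ T))); rewrite ?set11 //; by right.
have [X [cX okX]] := okp 0 isT; rewrite addn0 in okX.
have [w wW /andP[wY wX]] := fresh_vertex cX (cY isT).
have e : (l + r.+1.*2).+3 = (l.+2 + r.*2).+3 by arith.
have cY' : 0 < r -> r + dl <= #|(Y :\ w) :&: W|.
  move=> _; have := cY isT; rewrite (cardsD1 w (Y :&: W)) inE wY wW.
  by rewrite setIDAC; arith.
have rlen' T0 : r.+1.*2 <= len T0 by apply: leq_trans (rlen T0); arith.
have okp' j : j < r -> exists X : {set V}, #|X| <= dl /\
     forall w, w \in W -> w \notin X -> usable w (centre (front b (p.+1 + j))).
  by move=> jr; have := okp j.+1 jr; rewrite addnS -addSn.
have last' T0 : v T0 (front b (p.+1 + r).+1 T0 * K) \in (Y :\ w) :|: A.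
  have := last T0; rewrite addnS addSn !in_setU in_setD1 => /orP[lY|->]; rewrite ?orbT //.
  rewrite lY andbT; apply/orP; left; apply/eqP => E.
  by have := vW T0 (front b (p + r).+2 T0 * K); rewrite E wW.
rewrite addnS -addSn in okr.
rewrite e; have [[a1 a2 _]|[a1 a2 _]] := usable_slot T (okX w wW wX) wW wlW.
  have [|||U' [F' [v0' [bs' xF' xU' [wF' wU'] fUF']]]] :=
    @slot_step A Y l (front b p) r.+1 U F v0 T _ set0 _ rlen bs xF xU _ _ _ a1 a2 w isT wW wY erefl;
   rewrite ?sub0set //; try by left.
  exact: (IH p.+1 T l.+2 U' F' v0' (Y :\ w) w).
have [|||U' [F' [v0' [bs' xF' xU' [wF' wU'] fUF']]]] :=
    @slot_step A Y l (front b p) r.+1 U F v0 (~~ T) _ [set wl] _ rlen bs wF wU _ _ _ a1 a2 w isT wW wY erefl;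
   rewrite ?set11 //; try by right.
exact: (IH p.+1 (~~ T) l.+2 U' F' v0' (Y :\ w) w).
Qed.

(** At the start F need not contain a leftover vertex, provided that the first slot
    can be taken along the cycle T whose frontier joint is in F. *)
Lemma chain_start r T l U F v0 Y : chain_state A Y l b r.+1 U F v0 ->
  v T (b T * K) \in F -> v T (b T * K) \notin U ->
  (forall T, r.+1.*2 <= len T) -> (0 < r -> r + dl <= #|Y :&: W|) ->
  (forall j, j < r -> exists X : {set V}, #|X| <= dl /\
     forall w, w \in W -> w \notin X -> usable w (centre (front b j))) ->
  usable wc (centre (front b r)) ->
  (exists X : {set V}, [/\ #|X| <= dl, (r = 0 -> wc \notin X) &
     forall w, w \in W -> w \notin X -> slot_avail T (centre b) set0 w]) ->
  (forall T, v T (front b r.+1 T * K) \in Y :|: A) ->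
  contains_copy (@loose_cycle K.+1 (l + r.*2).+3) B.
Proof.
case: r => [|r] bs xF xU rlen cY okp okr [X [cX wcX avX]] last.
  rewrite addn0; apply: (chain_last bs xF xU _ _ _ (avX wc wcW (wcX erefl)) (last T)).
  - by rewrite sub0set.
  - by left.
  by left.
have [w wW /andP[wY wX]] := fresh_vertex cX (cY isT).
have [a1 a2 _] := avX w wW wX.
have e : (l + r.+1.*2).+3 = (l.+2 + r.*2).+3 by arith.
have [|||U' [F' [v0' [bs' xF' xU' [wF' wU'] fUF']]]] :=
    @slot_step A Y l b r.+1 U F v0 T _ set0 _ rlen bs xF xU _ _ _ a1 a2 w isT wW wY erefl;
   rewrite ?sub0set //; try by left.
rewrite e; apply: (@chain r 1 T l.+2 U' F' v0' (Y :\ w) w bs' xF' xU' wF' wU' wW fUF').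
- by move=> T0; apply: leq_trans (rlen T0); arith.
- move=> _; have := cY isT; rewrite (cardsD1 w (Y :&: W)) inE wY wW.
  by rewrite setIDAC; arith.
- by move=> j jr; have := okp j.+1 jr.
- exact: okr.
move=> T0; have := last T0; rewrite !in_setU in_setD1 => /orP[lY|->]; rewrite ?orbT //.
rewrite add1n lY andbT; apply/orP; left; apply/eqP => E.
by have := vW T0 (front b r.+2 T0 * K); rewrite E wW.
Qed.

End ChainInd.

Lemma neq_negb (T T' : bool) : T' <> T -> T' = ~~ T.
Proof. by case: T T' => [] []. Qed.

Lemma same (a : bool -> nat) T1 T2 s1 s2 : v T1 s1 = v T2 s2 ->
  a T1 <= s1 < a T1 + len T1 * K -> a T2 <= s2 < a T2 + len T2 * K ->
  T1 = T2 /\ s1 = s2.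
Proof.
case: (T1 =P T2) => [<-|ne E _ _]; last first.
  by exfalso; move: E; case: T1 T2 ne => [] [] // _ E;
     [have := v_neq true s1 s2|have := v_neq false s1 s2]; rewrite E eqxx.
by move=> E h1 h2; split => //; apply: (@v_inj T1 (a T1)) E.
Qed.

Lemma lpath1 (F : {set V}) u w : F \in B -> u \in F -> w \in F -> w != u -> lpath B 1 u w F.
Proof.
move=> FB uF wF wu; have -> : F = [set u] :|: F by rewrite (setUidPr _) ?sub1set.
apply: (lpathS (lpath0 B u)) => //.
by apply/setIidPr; rewrite sub1set.
Qed.

(** The form in which chains are started: if the vertices used so far, other than
    wc, lie on both cycles between the positions q and b, it suffices that the
    chain ends before it reaches q again, or at q when this is a starting
    point. *)
Lemma start_chain dl wc (A U F : {set V}) l v0 (b q : bool -> nat) r T :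
  (forall u, u \in A -> lpath B l u v0 U) -> F \in B -> F :&: U = [set v0] ->
  (forall z, z \in U :|: F -> z = wc \/
     exists T' s, q T' <= s <= b T' * K /\ z = v T' s) ->
  (forall T', q T' <= b T' * K) ->
  (forall T', (b T' + r.+1.*2) * K <= q T' + len T' * K) ->
  (forall T', (b T' + r.+1.*2) * K < q T' + len T' * K \/
              v T' ((b T' + r.+1.*2) * K) \in A) ->
  wc \in W -> wc \in A ->
  v T (b T * K) \in F -> v T (b T * K) \notin U ->
  (0 < r -> r + dl < #|W|) ->
  (forall j, j < r -> exists X : {set V}, #|X| <= dl /\
     forall w, w \in W -> w \notin X -> usable w (centre (front b j))) ->
  usable wc (centre (front b r)) ->
  (exists X : {set V}, [/\ #|X| <= dl, (r = 0 -> wc \notin X) &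
     forall w, w \in W -> w \notin X -> slot_avail T (centre b) set0 w]) ->
  contains_copy (@loose_cycle K.+1 (l + r.*2).+3) B.
Proof.
move=> pA FB FU pos qb bq last wcW wcA xF xU cW okp okr avX.
(* The last joint of each cycle is reserved along with W, since the last slot may
   end there, unless it is a starting point. *)
pose lst T' := v T' ((b T' + r.+1.*2) * K).
pose Y := (W :\ wc) :|: [set z in [seq lst T' | T' <- [:: true; false] & lst T' \notin A]].
have YP y : y \in Y -> (y \in W /\ y <> wc) \/ (exists2 T', y = lst T' & lst T' \notin A).
  rewrite in_setU in_setD1 inE => /orP[/andP[/eqP]|/mapP[T']]; first by left.
  by rewrite mem_filter => /andP[lA _ ->]; right; exists T'.
apply: (@chain_start A b dl wc wcW wcA r T l U F v0 Y) => //.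
- split => //.
    move=> T' s si; apply/negP => /pos[E|[T1 [s1 [s1i E]]]].
      by have := vW T' s; rewrite E wcW.
    have := bq T'; have := qb T'; have := bq T1; have := qb T1 => *.
    have [||? ?] := same (a := q) E; [arith|arith|subst; arith].
  split=> [T' s si|y /YP[[yW ywc]|[T' -> lA]]].
  - apply/negP => /YP[[]|[T1 E lA]]; first by rewrite (negPf (vW _ _)).
    have [h|h] := last T1; last by rewrite h in lA.
    have := qb T1; have := bq T' ; have := qb T' => *.
    have [||? ?] := same (a := fun T => b T * K) E; [arith|arith|subst; arith].
  - apply/negP => /pos[//|[T1 [s1 [_ E]]]]; have := vW T1 s1.
    by rewrite -E yW.
  apply/negP => /pos[E|[T1 [s1 [s1i E]]]].
    by have := vW T' ((b T' + r.+1.*2) * K); rewrite -/(lst T') E wcW.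
  have [h|h] := last T'; last by rewrite h in lA.
  have := qb T1; have := bq T1; have := qb T' => *.
  have [||? ?] := same (a := q) E; [arith|arith|subst; arith].
- move=> T'; have := bq T'; have := qb T' => ? ?.
  have : r.+1.*2 * K <= len T' * K by arith.
  by rewrite leq_mul2r; arith.
- move=> r0; have sub : W :\ wc \subset Y :&: W.
    by rewrite subsetI subsetUl subsetDl.
  have := subset_leq_card sub; have := cardsD1 wc W; rewrite wcW.
  by have := cW r0; arith.
move=> T'; rewrite in_setU; have [_|lA] := boolP (v T' (front b r.+1 T' * K) \in A).
  by rewrite orbT.
have e : v T' (front b r.+1 T' * K) = lst T' by rewrite /lst /front addnC.
rewrite orbF in_setU; apply/orP; right; rewrite inE e; apply: map_f.
by rewrite mem_filter -e lA; case: T' {e lA}.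
Qed.

(** * No exceptional centre *)
Section Regular.
Hypothesis reg : forall c, (forall T, 0 < c T) -> full true c \/ full false c.
Variable m : nat.
Hypotheses (lent : len true = m) (lenf : m < len false) (cardW : #|W| = (m - 1) %/ 2).

Lemma regular_usable c w : (forall T, 0 < c T) -> usable w c.
Proof. by move=> /reg[]; [left|right; left]. Qed.

Lemma regular_full c : (forall T, 0 < c T) -> exists T, full T c.
Proof. by move=> /reg[]; [exists true|exists false]. Qed.

Lemma len_ge T : m <= len T.
Proof. by case: T; [rewrite lent|apply: ltnW]. Qed.

(** At the centre (1, 1), along a full cycle T0, the blue edge F through wc contains
    the joint 2 of T0 and the joint 1 of the other cycle.  Since F reaches both
    frontiers, the first slot can run along either cycle. *)
Lemma blue_odd : 2 < m -> odd m -> contains_copy (@loose_cycle K.+1 m) B.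
Proof.
move=> m_gt2 om; pose r := (m - 3) %/ 2.
have mE : m = (0 + r.*2).+3 by rewrite /r; arith.
have [wc wcW] : exists w, w \in W by apply/set0Pn; rewrite -card_gt0 cardW; arith.
have [T0 f0] := regular_full (c := fun=> 1) (fun=> isT).
have [_ /(_ wc wcW)/availP[F [FB eF cF wF sF]]] := f0 true.
pose b T := if T == T0 then 2 else 1.
have [T f] := regular_full (c := centre b) (fun=> isT).
have bF T' : v T' (b T' * K) \in F.
  by rewrite /b; case: eqP => [->//|/neq_negb ->].
rewrite mE; apply: (@start_chain 0 wc [set wc] [set wc] F 0 wc b
  (fun T => if T == T0 then K.+1 else K) r T) => //.
- by move=> u /set1P ->; apply: lpath0.
- by apply/setIidPr.
- move=> z; rewrite in_setU in_set1 => /orP[/eqP|/sF[->|->|[s si ->]|/set1P]]; [by left|right|right|right|by left].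
  + by exists T0, (2 * K); rewrite /b eqxx; split => //=; arith.
  + exists (~~ T0), (1 * K); rewrite /b.
    by have -> : (~~ T0 == T0) = false by [case: (T0)]; split => //; arith.
  by exists T0, s; rewrite /b eqxx; split => //; rewrite /= in si; arith.
- by move=> T'; rewrite /b; case: eqP; arith.
- move=> T'; have h : m * K <= len T' * K by rewrite leq_mul2r len_ge orbT.
  by rewrite /b; case: eqP => _; move: h; rewrite {1}mE; arith.
- move=> T'; left; have h : m * K <= len T' * K by rewrite leq_mul2r len_ge orbT.
  by rewrite /b; case: eqP => _; move: h; rewrite {1}mE; arith.
- by rewrite set11.
- by apply/set1P => E; have := vW T (b T * K); rewrite E wcW.
- by move=> r0; rewrite cardW /r; arith.
- by move=> j _; exists set0; rewrite cards0; split => // w _ _; apply: regular_usable.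
- exact: regular_usable.
by exists set0; split; rewrite ?cards0 ?inE // => w wW _; apply: full_slot.
Qed.

Lemma full_ext T c c' : c =1 c' -> full T c -> full T c'.
Proof.
move=> cc' f d; rewrite /full /avail -!cc'; exact: f.
Qed.

(** The frontier from which the next centre is two joints ahead of c on T, and 1 + d
    joints ahead on the other cycle. *)
Definition knight T (d : nat) (c : bool -> nat) T' := if T' == T then (c T).+1 else c T' + d.

(** One of the cycles is full at each point of the grid of centres.  If no knight
    move of the required form exists, the choice made at (0, 0) propagates, by
    moves with both values of d, to two points which impose contradictory
    choices at (6, 6). *)
Lemma knight_pair : exists T c d, [/\ forall T', 0 < c T', d <= 1, full T c &
  full T (centre (knight T d c))].
Proof.
pose cc (i j : nat) (T : bool) := if T then i.+1 else j.+1.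
have cc_gt0 i j T : 0 < cc i j T by case: T.
have win T i j i' j' d : d <= 1 -> centre (knight T d (cc i j)) =1 cc i' j' ->
    full T (cc i j) -> full T (cc i' j') -> exists T c d, [/\ forall T', 0 < c T',
    d <= 1, full T c & full T (centre (knight T d c))].
  move=> d1 E f f'; exists T, (cc i j), d; split => //.
  by apply: full_ext f' => T'; rewrite E.
have reg2 i j : full true (cc i j) \/ full false (cc i j) by apply: reg.
have winC i j d : d <= 1 -> full true (cc i j) -> full true (cc i.+2 (j + d).+1) -> _ :=
  fun h => win true i j i.+2 (j + d).+1 d h (fun T' => ltac:(by case: T')).
have winD i j d : d <= 1 -> full false (cc i j) -> full false (cc (i + d).+1 j.+2) -> _ :=
  fun h => win false i j (i + d).+1 j.+2 d h (fun T' => ltac:(by case: T')).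
(* C and D tell which of the cycles true and false is full at the given point. *)
have [C00|D00] := reg2 0 0.
  have [|D21] := reg2 2 1; first exact: (winC 0 0 0).
  have [|D22] := reg2 2 2; first exact: (winC 0 0 1).
  have [C33|] := reg2 3 3; last exact: (winD 2 1 0).
  have [C44|] := reg2 4 4; last exact: (winD 2 2 1).
  have [|D54] := reg2 5 4; first exact: (winC 3 3 0).
  have [|] := reg2 6 6; [exact: (winC 4 4 1)|exact: (winD 5 4 0)].
have [C12|] := reg2 1 2; last exact: (winD 0 0 0).
have [C22|] := reg2 2 2; last exact: (winD 0 0 1).
have [|D33] := reg2 3 3; first exact: (winC 1 2 0).
have [|D44] := reg2 4 4; first exact: (winC 2 2 1).
have [C45|] := reg2 4 5; last exact: (winD 3 3 0).
have [|] := reg2 6 6; [exact: (winC 4 5 0)|exact: (winD 4 4 1)].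
Qed.

(** At the first centre of a knight pair, the edges U through wc and F on the two
    sides make a path of two edges, and F ends at the joint of T from which the slot
    at the second centre starts.  If all slots run along T, each of the m edges
    advances by one joint: when T has length m, the last slot comes back exactly to
    the first joint of U, hence the second starting point in A. *)
Lemma blue_even : 3 < m -> ~~ odd m -> contains_copy (@loose_cycle K.+1 m) B.
Proof.
move=> m_gt3 om; pose r := (m - 4) %/ 2.
have mE : m = (1 + r.*2).+3 by rewrite /r; arith.
have [wc wcW] : exists w, w \in W by apply/set0Pn; rewrite -card_gt0 cardW; arith.
have [T [c [d [c_gt0 d1 fc fn]]]] := knight_pair.
have [_ /(_ wc wcW)/availP[U [UB eU cU wU sU]]] := fc false.
have [/availP[F [FB eF cF _ sF]] _] := fc true.
have TnT : (~~ T == T) = false by case: (T).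
have cT : (c T).-1.+1 = c T by rewrite prednK.
have kT : c T * K = (c T).-1 * K + K by rewrite -{1}cT mulSn addnC.
have lK T' : (r.*2 + 4) * K <= len T' * K.
  by rewrite leq_mul2r; have := len_ge T'; rewrite {1}mE; arith.
pose a T' := if T' == T then (c T).-1 * K else c T' * K.
have nU T' s : v T' s != wc by apply: contraTneq wcW => <-; apply: vW.
have bT : knight T d c T = (c T).+1 by rewrite /knight eqxx.
have bF : knight T d c (~~ T) = c (~~ T) + d by rewrite /knight TnT.
have aT : a T = (c T).-1 * K by rewrite /a eqxx.
have aF : a (~~ T) = c (~~ T) * K by rewrite /a TnT.
have cases (P : bool -> Prop) : P T -> P (~~ T) -> forall T', P T'.
  by move=> h1 h2 T'; case: (T' =P T) => [->//|/neq_negb ->].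
have lKT := lK T; have lKF := lK (~~ T).
have d1K : d * K <= K by rewrite -{2}[K]mul1n leq_mul2r d1 orbT.
have sU' z : z \in U -> [\/ z = wc, z = v (~~ T) (c (~~ T) * K) |
    exists2 s, (c T).-1 * K <= s < c T * K & z = v T s].
  move=> /sU[->|->|[s si ->]|/set1P->]; [|by constructor 2| |by constructor 1].
    by constructor 3; exists ((c T).-1 * K) => //=; arith.
  by constructor 3; exists s => //; rewrite /= in si; arith.
have sF' z : z \in F -> z = v (~~ T) (c (~~ T) * K) \/
    exists2 s, c T * K < s <= (c T).+1 * K & z = v T s.
  move=> /sF[->|->|[s si ->]|]; [|by left| |by rewrite inE].
    by right; exists ((c T).+1 * K) => //=; arith.
  by right; exists s => //; rewrite /= in si; arith.
have vv s s' : v T s <> v (~~ T) s' by move=> E; have := v_neq T s s'; rewrite E eqxx.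
have FU z : z \in F -> z \in U -> z = v (~~ T) (c (~~ T) * K).
  move=> /sF'[//|[s si ->]] /sU'[|//|[s' s'i]]; first by move/eqP; rewrite (negPf (nU _ _)).
  move=> E; have [||_ E'] := same (a := a) E; rewrite ?aT; arith.
rewrite mE; apply: (@start_chain 0 wc [set wc; v T ((c T).-1 * K)] U F 1
   (v (~~ T) (c (~~ T) * K)) (knight T d c) a r T) => //.
- move=> u /set2P[] ->; apply: lpath1 => //; last first.
  + by apply/eqP => E; apply: (vv ((c T).-1 * K) (c (~~ T) * K)).
  + by rewrite sub1set in wU.
- apply/setP => z; rewrite in_setI in_set1; apply/andP/eqP => [[]|->//].
  exact: FU.
- move=> z; rewrite in_setU => /orP[/sU'[->|->|[s si ->]]|/sF'[->|[s si ->]]].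
  + by left.
  + by right; exists (~~ T), (c (~~ T) * K); rewrite aF bF; split => //; arith.
  + by right; exists T, s; rewrite aT bT; split => //; arith.
  + by right; exists (~~ T), (c (~~ T) * K); rewrite aF bF; split => //; arith.
  by right; exists T, s; rewrite aT bT; split => //; arith.
- by apply: cases; rewrite ?aT ?aF ?bT ?bF; arith.
- by apply: cases; rewrite ?aT ?aF ?bT ?bF; arith.
- apply: cases; rewrite ?aT ?aF ?bT ?bF; last by left; arith.
  have [TE|TE] : T = true \/ T = false by case: (T); [left|right].
    right; rewrite in_set2; apply/orP; right; apply/eqP.
    have <- : v T ((c T).-1 * K + 1 * (len T * K)) = v T ((c T).-1 * K).
      exact: (v_per).
    congr (v T _); rewrite [in len _]TE lent [in RHS]mE; arith.
  left; have : (r.*2 + 5) * K <= len T * K.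
    by rewrite leq_mul2r TE; move: lenf; rewrite {1}mE; arith.
  by arith.
- by rewrite set21.
- by rewrite bT.
- rewrite bT; apply/negP => /sU'[/eqP|/vv//|[s si E]]; first by rewrite (negPf (nU _ _)).
  have [||_ E'] := same (a := a) E; rewrite ?aT; arith.
- by move=> r0; rewrite cardW /r; arith.
- by move=> j _; exists set0; rewrite cards0; split => // w _ _; apply: regular_usable.
- exact: regular_usable.
by exists set0; split; rewrite ?cards0 ?inE // => w wW _; apply: full_slot.
Qed.

End Regular.

(** * Exceptional centres *)
Lemma lpath_ext l u w0 w (U F : {set V}) : lpath B l u w0 U -> F \in B -> w0 \in F ->
  w \in F -> w != w0 -> (forall z, z \in F -> z \in U -> z = w0) ->
  lpath B l.+1 u w (U :|: F).
Proof.
move=> p FB vF wF wv FU; apply: (lpathS p) => //.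
apply/setP => z; rewrite in_setI in_set1; apply/andP/eqP => [[]|->]; first exact: FU.
by have [] := lpath_ends p.
Qed.

Lemma close_ext l u w (U F : {set V}) : lpath B l u w U -> F \in B -> u \in F ->
  w \in F -> u != w -> (forall z, z \in F -> z \in U -> z = u \/ z = w) ->
  contains_copy (@loose_cycle K.+1 l.+1) B.
Proof.
move=> p FB uF wF uw FU; have [uU wU] := lpath_ends p.
apply: (lpath_close _ Buni p FB uw); first by rewrite ltnS ltnW.
apply/setP => z; rewrite in_setI in_set2; apply/andP/orP => [[zF zU]|[]/eqP-> //].
by case: (FU z zF zU) => ->; [left|right].
Qed.

(** An edge is located by the predicate D satisfied by the positions of its vertices
    on the cycles, and the set ws of its leftover vertices. *)
Definition within (F : {set V}) (D : bool -> nat -> bool) (ws : {set V}) :=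
  forall z, z \in F -> (exists T s, D T s /\ z = v T s) \/ z \in ws.

(** Intersections of edges are computed on positions: if all positions lie in one
    period, starting at p, common vertices come from common positions. *)
Lemma within_meet (p : bool -> nat) (F G : {set V}) D D' ws ws' (P : V -> Prop) :
  within F D ws -> within G D' ws' -> ws \subset W -> ws' \subset W ->
  (forall T s, D T s -> p T <= s < p T + len T * K) ->
  (forall T s, D' T s -> p T <= s < p T + len T * K) ->
  (forall T s, D T s -> D' T s -> P (v T s)) ->
  (forall w, w \in ws -> w \in ws' -> P w) ->
  forall z, z \in F -> z \in G -> P z.
Proof.
move=> dF dG sW sW' pD pD' PD Pw z /dF[[T [s [Ds ->]]]|zw] /dG[[T' [s' [Ds' E]]]|zw'].
- by have [TT' ss'] := same E (pD _ _ Ds) (pD' _ _ Ds'); subst; apply: PD.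
- by have := vW T s; rewrite (subsetP sW').
- by have := vW T' s'; rewrite -E (subsetP sW).
exact: Pw.
Qed.

(** The picture at an exceptional centre, with positions instead of joints: the
    centre is at p + K on each cycle, the edges before and after it cover the
    positions from p to p + 2K, and zs T is the position of the distinguished
    vertex of T.  The flags [own] and [fz] tell whether the edge is asked to
    contain the distinguished vertex of its own cycle and of the other one. *)
Section Data.
Variable p : bool -> nat.

Definition side (d : bool) q s := if d then q + K < s <= q + 2 * K else q <= s < q + K.

Definition edge (zs : bool -> nat) T d (own fz : bool) (ws F : {set V}) :=
  [/\ F \in B, v T (if d then p T + 2 * K else p T) \in F,
      v (~~ T) (p (~~ T) + K) \in F,
      (own -> v T (zs T) \in F) /\ (fz -> v (~~ T) (zs (~~ T)) \in F) &
      ws \subset F /\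
      within F (fun T' s => if T' == T then side d (p T) s
                          else (s == p T' + K) || fz && (s == zs T')) ws].

Definition frame w0 (e : bool -> bool) (zs : bool -> nat) :=
  [/\ w0 \in W,
   forall T, if e T then p T + K < zs T < p T + 2 * K else p T < zs T < p T + K &
   forall T d (own fz : bool) (ws : {set V}), (own -> d = e T) -> ws \subset W :\ w0 ->
     own + fz + #|ws| <= 2 -> exists F, edge zs T d own fz ws F].

End Data.

(** Two prescribed vertices are always allowed because K > 2. *)
Lemma exceptional_frame w0 c p : (forall T, 0 < c T) -> (forall T, (c T).-1 * K = p T) ->
  exceptional w0 c -> exists e zs, frame p w0 e zs.
Proof.
move=> c_gt0 pE [w0W [e [z [zi sav]]]].
have cK T : c T * K = p T + K by rewrite -pE -{1}(prednK (c_gt0 T)) mulSn addnC.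
have [zt zti ztE] := segP _ _ _ _ (zi true).
have [zf zfi zfE] := segP _ _ _ _ (zi false).
pose zs (T : bool) := if T then zt else zf.
have zsE T : z T = v T (zs T) by case: T.
have zsi T : (low (e T) (c T) * K).+1 <= zs T < (low (e T) (c T)).+1 * K by case: T.
exists e, zs; split => //.
  by move=> T; have := zsi T; rewrite /low; have := cK T; have := pE T; case: (e T) => /=; arith.
move=> T d own fz ws oe sW cws.
pose Z1 := if own then [set z T] else set0.
pose Z2 := if fz then [set z (~~ T)] else set0.
have cZ1 : #|Z1| <= own by rewrite /Z1; case: (own); rewrite ?cards1 ?cards0.
have cZ2 : #|Z2| <= fz by rewrite /Z2; case: (fz); rewrite ?cards1 ?cards0.
have [||F [FB eF cF ZF sF]] := availP (sav T d (Z1 :|: Z2 :|: ws) _ _).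
- rewrite !subUset -andbA; apply/and3P; split; last by rewrite (subset_trans sW) ?subsetUr.
  + rewrite /Z1; case: (own) oe => [->//|_]; rewrite ?sub0set //.
    by rewrite sub1set !in_setU zi.
  by rewrite /Z2; case: (fz); rewrite ?sub0set // sub1set !in_setU in_set1 eqxx orbT.
- have := (leq_card_setU (Z1 :|: Z2) ws, leq_card_setU Z1 Z2).
  by move=> [h1 h2]; move: (leq_trans h1 (leqnn _)) (leq_trans h2 (leqnn _)); arith.
exists F; split => //.
- move: eF; rewrite /far; case: (d) => /=; last by rewrite pE.
  by have -> : (c T).+1 * K = p T + 2 * K by have := cK T; arith.
- by move: cF; rewrite cK.
- move: ZF; rewrite !subUset /Z1 /Z2 => /andP[/andP[h1 h2] _]; split => h.
    by move: h1; rewrite h sub1set zsE.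
  by move: h2; rewrite h sub1set zsE.
split; first by apply: subset_trans ZF; rewrite subsetUr.
move=> x /sF[->|->|[s si ->]|].
- left; exists T, (far d (c T) * K); rewrite eqxx /far /side; split => //.
  by have := cK T; have := pE T; case: (d) => /=; arith.
- left; exists (~~ T), (c (~~ T) * K); have -> : (~~ T == T) = false by case: (T).
  by rewrite {1}cK eqxx.
- left; exists T, s; rewrite eqxx /side; split => //; move: si; rewrite /low.
  by have := cK T; have := pE T; case: (d) => /=; arith.
rewrite !in_setU => /orP[/orP[]|]; last by right.
  rewrite /Z1; case: (own) oe => [/(_ isT) de|_]; last by rewrite inE.
  move=> /set1P ->; left; exists T, (zs T); rewrite eqxx zsE de /side; split => //.
  by have := zsi T; rewrite /low; have := cK T; have := pE T; case: (e T) => /=; arith.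
rewrite /Z2; case: (fz); last by rewrite inE.
move=> /set1P ->; left; exists (~~ T), (zs (~~ T)); rewrite zsE.
by have -> : (~~ T == T) = false by [case: (T)]; rewrite eqxx orbT.
Qed.

Section Frame.
Variables (p : bool -> nat) (w0 : V) (e : bool -> bool) (zs : bool -> nat).
Hypothesis sp : frame p w0 e zs.

Ltac meet_tac zt zf lK :=
  rewrite ?sub0set //; try (by move=> w; rewrite ?inE);
  move=> [] s /=; move: zt zf (lK true) (lK false); rewrite /side; clear;
  case: (e true); case: (e false) => /= *; solve [arith | congr (v _ _); arith].

Let tf s s' : v true s != v false s'. Proof. exact: (v_neq true). Qed.
Let ft s s' : v false s != v true s'. Proof. exact: (v_neq false). Qed.
Let lK := len_K.

(** One edge contains both distinguished vertices; the two others, one through each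
    of these vertices, are on the two sides of the cycle [false] and meet at the
    centre on the cycle [true]. *)
Lemma blue3 : contains_copy (@loose_cycle K.+1 3) B.
Proof.
have [w0W zi cross] := sp; have zt := zi true; have zf := zi false.
have [//||F1 [F1B _ _ [/(_ isT) t1 /(_ isT) f1] [_ d1]]] :=
  cross true (e true) true true set0 _ (sub0set _); first by rewrite cards0.
have [//||F2 [F2B _ c2 [/(_ isT) f2 _] [_ d2]]] :=
  cross false (e false) true false set0 _ (sub0set _); first by rewrite cards0.
have [//||F3 [F3B _ c3 [_ /(_ isT) t3] [_ d3]]] :=
  cross false (~~ e false) false true set0 _ (sub0set _); first by rewrite cards0.
rewrite /= in c2 c3 t3 f1.
have m12 z : z \in F2 -> z \in F1 -> z = v false (zs false).
  by move: z; apply: (within_meet (p := p) d2 d1); meet_tac zt zf lK.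
have m13 z : z \in F3 -> z \in F1 -> z = v true (zs true).
  by move: z; apply: (within_meet (p := p) d3 d1); meet_tac zt zf lK.
have m23 z : z \in F3 -> z \in F2 -> z = v true (p true + K).
  by move: z; apply: (within_meet (p := p) d3 d2); meet_tac zt zf lK.
have zc : v true (zs true) != v true (p true + K).
  apply/eqP => /(same (a := p)); move: zt (lK true) K_gt1; clear.
  by case: (e true) => zt lK K_gt1 [|| _]; arith.
have p1 := lpath1 F1B t1 f1 (ft _ _).
have p2 := lpath_ext p1 F2B f2 c2 (tf _ _) m12.
apply: (close_ext p2 F3B t3 c3 zc) => z zF; rewrite in_setU => /orP[].
  by move/(m13 z zF); left.
by move/(m23 z zF); right.
Qed.

(** The two edges of the cycle [true] meet at the centre on [false], and conversely;
    each edge of [true] meets one of [false] in a distinguished vertex. *)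
Lemma blue4 : contains_copy (@loose_cycle K.+1 4) B.
Proof.
have [w0W zi cross] := sp; have zt := zi true; have zf := zi false.
have [//||F1 [F1B _ c1 [/(_ isT) t1 _] [_ d1]]] :=
  cross true (e true) true false set0 _ (sub0set _); first by rewrite cards0.
have [//||F2 [F2B _ c2 [_ /(_ isT) t2] [_ d2]]] :=
  cross false (~~ e false) false true set0 _ (sub0set _); first by rewrite cards0.
have [//||F3 [F3B _ c3 [/(_ isT) f3 _] [_ d3]]] :=
  cross false (e false) true false set0 _ (sub0set _); first by rewrite cards0.
have [//||F4 [F4B _ c4 [_ /(_ isT) f4] [_ d4]]] :=
  cross true (~~ e true) false true set0 _ (sub0set _); first by rewrite cards0.
rewrite /= in c1 c2 c3 c4 t2 f4.
have m12 z : z \in F2 -> z \in F1 -> z = v true (zs true).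
  by move: z; apply: (within_meet (p := p) d2 d1); meet_tac zt zf lK.
have m13 z : z \in F3 -> z \in F1 -> False.
  by move: z; apply: (within_meet (p := p) d3 d1); meet_tac zt zf lK.
have m23 z : z \in F3 -> z \in F2 -> z = v true (p true + K).
  by move: z; apply: (within_meet (p := p) d3 d2); meet_tac zt zf lK.
have m14 z : z \in F4 -> z \in F1 -> z = v false (p false + K).
  by move: z; apply: (within_meet (p := p) d4 d1); meet_tac zt zf lK.
have m24 z : z \in F4 -> z \in F2 -> False.
  by move: z; apply: (within_meet (p := p) d4 d2); meet_tac zt zf lK.
have m34 z : z \in F4 -> z \in F3 -> z = v false (zs false).
  by move: z; apply: (within_meet (p := p) d4 d3); meet_tac zt zf lK.
have zc T : v T (zs T) != v T (p T + K).
  apply/eqP => /(same (a := p)); move: (zi T) (lK T) K_gt1; clear.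
  by case: (e T) => zt lK K_gt1 [|| _]; arith.
have p1 := lpath1 F1B c1 t1 (tf _ _).
have p2 : lpath B 2 (v false (p false + K)) (v true (p true + K)) (F1 :|: F2).
  by apply: (lpath_ext p1 F2B t2 c2) => //; rewrite eq_sym.
have p3 : lpath B 3 (v false (p false + K)) (v false (zs false)) (F1 :|: F2 :|: F3).
  apply: (lpath_ext p2 F3B c3 f3) => // z zF.
  by rewrite in_setU => /orP[/(m13 z zF)|/(m23 z zF)].
apply: (close_ext p3 F4B c4 f4); first by rewrite eq_sym.
move=> z zF; rewrite !in_setU => /orP[/orP[]|].
- by move/(m14 z zF); left.
- by move/(m24 z zF).
by move/(m34 z zF); right.
Qed.

(** Two exceptional centres, two joints apart on both cycles, with different
    exceptional vertices. *)
Section Double.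
Variables (w1 : V) (e' : bool -> bool) (zs' : bool -> nat).
Hypothesis sp' : frame (fun T => p T + 2 * K) w1 e' zs'.
Hypotheses (w01 : w0 != w1) (len_gt4 : forall T, 4 < len T).

Ltac meet_tac2 lK :=
  rewrite ?sub0set ?sub1set //; try (by move=> w; rewrite ?inE);
  try (by move=> w /set1P-> /set1P);
  try (by move=> w /set1P-> /set1P/eqP; rewrite ?(negPf w01) // eq_sym (negPf w01));
  move=> [] s /=; move: K_gt1 (lK true) (lK false); rewrite /side; clear => /= *;
  solve [arith | congr (v _ _); arith].

(** The exceptional vertex of each centre is free to be used at the other one: w1
    links two edges at the first centre and w0 two edges at the second.  The
    5-cycle is closed at joints shared by the two centres; for the 6-cycle the last
    edge is replaced by the path made of the two edges of [true] at the second
    centre. *)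
Lemma blue5_blue6 : contains_copy (@loose_cycle K.+1 5) B /\ contains_copy (@loose_cycle K.+1 6) B.
Proof.
have [w0W _ cross] := sp; have [w1W _ cross'] := sp'.
have lK5 T : 5 * K <= len T * K by rewrite leq_mul2r len_gt4 orbT.
have s1 : [set w1] \subset W :\ w0 by rewrite sub1set in_setD1 w1W eq_sym w01.
have s0 : [set w0] \subset W :\ w1 by rewrite sub1set in_setD1 w0W w01.
have [//||G0 [G0B n0 c0 _ [_ d0]]] :=
  cross true true false false set0 _ (sub0set _); first by rewrite cards0.
have [//||G1 [G1B _ c1 _ [x1 d1]]] := cross true false false false _ _ s1; first by rewrite cards1.
have [//||G2 [G2B n2 _ _ [x2 d2]]] := cross false true false false _ _ s1; first by rewrite cards1.
have [//||G3 [G3B n3 _ _ [x3 d3]]] := cross' false false false false _ _ s0; first by rewrite cards1.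
have [//||G4 [G4B n4 _ _ [x4 d4]]] := cross' true false false false _ _ s0; first by rewrite cards1.
have [//||H4 [H4B _ h4 _ [y4 b4]]] := cross' true true false false _ _ s0; first by rewrite cards1.
have [//||H5 [H5B k5 h5 _ [_ b5]]] :=
  cross' true false false false set0 _ (sub0set _); first by rewrite cards0.
rewrite !sub1set /= in n0 c0 c1 n2 n3 n4 h4 h5 k5 x1 x2 x3 x4 y4.
have m01 z : z \in G1 -> z \in G0 -> z = v false (p false + K).
  by move: z; apply: (within_meet (p := p) d1 d0); meet_tac2 lK5.
have m02 z : z \in G2 -> z \in G0 -> False.
  by move: z; apply: (within_meet (p := p) d2 d0); meet_tac2 lK5.
have m12 z : z \in G2 -> z \in G1 -> z = w1.
  by move: z; apply: (within_meet (p := p) d2 d1); meet_tac2 lK5.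
have m03 z : z \in G3 -> z \in G0 -> False.
  by move: z; apply: (within_meet (p := p) d3 d0); meet_tac2 lK5.
have m13 z : z \in G3 -> z \in G1 -> False.
  by move: z; apply: (within_meet (p := p) d3 d1); meet_tac2 lK5.
have m23 z : z \in G3 -> z \in G2 -> z = v false (p false + 2 * K).
  by move: z; apply: (within_meet (p := p) d3 d2); meet_tac2 lK5.
have m04 z : z \in G4 -> z \in G0 -> z = v true (p true + 2 * K).
  by move: z; apply: (within_meet (p := p) d4 d0); meet_tac2 lK5.
have m14 z : z \in G4 -> z \in G1 -> False.
  by move: z; apply: (within_meet (p := p) d4 d1); meet_tac2 lK5.
have m24 z : z \in G4 -> z \in G2 -> False.
  by move: z; apply: (within_meet (p := p) d4 d2); meet_tac2 lK5.
have m34 z : z \in G4 -> z \in G3 -> z = w0.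
  by move: z; apply: (within_meet (p := p) d4 d3); meet_tac2 lK5.
have nW T s w : w \in W -> v T s != w by move=> wW; apply: contraNneq (vW T s) => ->.
have n1 : w1 != v false (p false + K) by rewrite eq_sym nW.
have p1 := lpath1 G0B n0 c0 (ft _ _).
have p2 := lpath_ext p1 G1B c1 x1 n1 m01.
have p3 : lpath B 3 (v true (p true + 2 * K)) (v false (p false + 2 * K)) (G0 :|: G1 :|: G2).
  apply: (lpath_ext p2 G2B x2 n2); first exact: nW.
  by move=> z zG; rewrite in_setU => /orP[/(m02 z zG)|/(m12 z zG)].
have p4 : lpath B 4 (v true (p true + 2 * K)) w0 (G0 :|: G1 :|: G2 :|: G3).
  apply: (lpath_ext p3 G3B n3 x3); first by rewrite eq_sym nW.
  by move=> z zG; rewrite !in_setU => /orP[/orP[/(m03 z zG)|/(m13 z zG)]|/(m23 z zG)].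
split.
  apply: (close_ext p4 G4B n4 x4); first exact: nW.
  move=> z zG; rewrite !in_setU => /orP[/orP[/orP[|]|]|].
  - by move/(m04 z zG); left.
  - by move/(m14 z zG).
  - by move/(m24 z zG).
  by move/(m34 z zG); right.
have k0 z : z \in H4 -> z \in G0 -> False.
  by move: z; apply: (within_meet (p := p) b4 d0); meet_tac2 lK5.
have k1 z : z \in H4 -> z \in G1 -> False.
  by move: z; apply: (within_meet (p := p) b4 d1); meet_tac2 lK5.
have k2 z : z \in H4 -> z \in G2 -> False.
  by move: z; apply: (within_meet (p := p) b4 d2); meet_tac2 lK5.
have k3 z : z \in H4 -> z \in G3 -> z = w0.
  by move: z; apply: (within_meet (p := p) b4 d3); meet_tac2 lK5.
have l0 z : z \in H5 -> z \in G0 -> z = v true (p true + 2 * K).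
  by move: z; apply: (within_meet (p := p) b5 d0); meet_tac2 lK5.
have l1 z : z \in H5 -> z \in G1 -> False.
  by move: z; apply: (within_meet (p := p) b5 d1); meet_tac2 lK5.
have l2 z : z \in H5 -> z \in G2 -> False.
  by move: z; apply: (within_meet (p := p) b5 d2); meet_tac2 lK5.
have l3 z : z \in H5 -> z \in G3 -> False.
  by move: z; apply: (within_meet (p := p) b5 d3); meet_tac2 lK5.
have l4 z : z \in H5 -> z \in H4 -> z = v false (p false + 2 * K + K).
  by move: z; apply: (within_meet (p := p) b5 b4); meet_tac2 lK5.
have p5 : lpath B 5 (v true (p true + 2 * K)) (v false (p false + 2 * K + K))
    (G0 :|: G1 :|: G2 :|: G3 :|: H4).
  apply: (lpath_ext p4 H4B y4 h4); first exact: nW.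
  move=> z zG; rewrite !in_setU => /orP[/orP[/orP[|]|]|].
  - by move/(k0 z zG).
  - by move/(k1 z zG).
  - by move/(k2 z zG).
  by move/(k3 z zG).
apply: (close_ext p5 H5B k5 h5); first exact: tf.
move=> z zG; rewrite !in_setU => /orP[/orP[/orP[/orP[|]|]|]|].
- by move/(l0 z zG); left.
- by move/(l1 z zG).
- by move/(l2 z zG).
- by move/(l3 z zG).
by move/(l4 z zG); right.
Qed.
End Double.

(** Starts of a chain at an exceptional centre: the chain goes on from the joints two
    steps after p, with at most one forbidden vertex at each centre. *)
Section Exceptional.
Variables (wc : V) (b : bool -> nat) (r : nat) (T : bool).
Hypotheses (wcW : wc \in W) (wc0 : wc != w0).
Hypothesis bK : forall T', b T' * K = p T' + 2 * K.
Hypothesis len_r : forall T', r.*2 + 4 < len T'.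
Hypothesis cW : 0 < r -> r + 1 < #|W|.
Hypothesis okp : forall j, j < r -> exists X : {set V}, #|X| <= 1 /\
     forall w, w \in W -> w \notin X -> usable w (centre (front b j)).
Hypothesis okr : usable wc (centre (front b r)).
Hypothesis nat_T : exists X : {set V}, [/\ #|X| <= 1, (r = 0 -> wc \notin X) &
     forall w, w \in W -> w \notin X -> slot_avail T (centre b) set0 w].

Ltac meet_tac3 zt zf :=
  rewrite ?sub0set ?sub1set //; try (by move=> w; rewrite ?inE);
  move=> [] s /=; move: K_gt1 zt zf (lK true) (lK false); rewrite /side; clear;
  case: T => /=; case: (e true); case: (e false) => /= *; solve [arith | congr (v _ _); arith].

Lemma start_frame l (U F : {set V}) : lpath B l wc (v (~~ T) (p (~~ T) + K)) U ->
  F \in B -> (forall z, z \in F -> z \in U -> z = v (~~ T) (p (~~ T) + K)) ->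
  v (~~ T) (p (~~ T) + K) \in F ->
  (forall z, z \in U :|: F -> z = wc \/
     exists T' s, p T' <= s <= p T' + 2 * K /\ z = v T' s) ->
  v T (p T + 2 * K) \in F -> v T (p T + 2 * K) \notin U ->
  contains_copy (@loose_cycle K.+1 (l + r.*2).+3) B.
Proof.
move=> pU FB FU cF pos xF xU; have [_ cU] := lpath_ends pU.
have lr T' : (r.*2 + 5) * K <= len T' * K by rewrite leq_mul2r; have := len_r T'; arith.
apply: (start_chain (dl := 1) (wc := wc) (A := [set wc])
  (U := U) (F := F) (v0 := v (~~ T) (p (~~ T) + K)) (b := b) (q := p) (T := T)) => //.
- by move=> u /set1P ->.
- apply/setP => z; rewrite in_setI in_set1; apply/andP/eqP => [[]|->//]; exact: FU.
- by move=> z /pos[->|[T' [s [si ->]]]]; [left|right; exists T', s; rewrite bK].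
- by move=> T'; rewrite bK; arith.
- by move=> T'; have := bK T'; have := lr T'; arith.
- by move=> T'; left; have := bK T'; have := lr T'; arith.
- exact: set11.
- by rewrite bK.
by rewrite bK.
Qed.

Let nW T' s w : w \in W -> v T' s != w.
Proof. by move=> wW; apply: contraNneq (vW T' s) => ->. Qed.

Lemma within_range (F : {set V}) D :
  within F D [set wc] \/ within F D set0 ->
  (forall T' s, D T' s -> p T' <= s <= p T' + 2 * K) ->
  forall z, z \in F -> z = wc \/ exists T' s, p T' <= s <= p T' + 2 * K /\ z = v T' s.
Proof.
move=> dF sD z zF; case: dF => /(_ z zF)[[T' [s [Ds ->]]]|]; rewrite ?inE //.
- by right; exists T', s; split; first exact: sD.
- by move/eqP; left.
by right; exists T', s; split; first exact: sD.
Qed.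

Ltac range_tac zt zf :=
  move=> [] s /=; move: K_gt1 zt zf; rewrite /side; clear;
  case: T => /=; case: (e true); case: (e false) => /= *; arith.

(** A path of three edges from wc to the frontier joint of T: the first edge, on the
    other cycle, reaches its distinguished vertex, through which it is linked to
    the slot along T at the exceptional centre. *)
Lemma start_odd : contains_copy (@loose_cycle K.+1 (2 + r.*2).+3) B.
Proof.
have [w0W zi cross] := sp; have zt := zi true; have zf := zi false.
have swc : [set wc] \subset W :\ w0 by rewrite sub1set in_setD1 wc0 wcW.
have swW : [set wc] \subset W by rewrite sub1set.
have [//||G1 [G1B _ c1 [/(_ isT) z1 _] [w1 d1]]] :=
  cross (~~ T) (e (~~ T)) true false _ _ swc; first by rewrite cards1.
have [//||G2 [G2B _ c2 [_ /(_ isT) z2] [_ d2]]] :=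
  cross T false false true set0 _ (sub0set _); first by rewrite cards0.
have [//||F [FB n3 c3 _ [_ d3]]] :=
  cross T true false false set0 _ (sub0set _); first by rewrite cards0.
rewrite !sub1set /= in n3 w1.
have m12 z : z \in G2 -> z \in G1 -> z = v (~~ T) (zs (~~ T)).
  by move: z; apply: (within_meet (p := p) d2 d1); meet_tac3 zt zf.
have m13 z : z \in F -> z \in G1 -> False.
  by move: z; apply: (within_meet (p := p) d3 d1); meet_tac3 zt zf.
have m23 z : z \in F -> z \in G2 -> z = v (~~ T) (p (~~ T) + K).
  by move: z; apply: (within_meet (p := p) d3 d2); meet_tac3 zt zf.
have zc : v (~~ T) (p (~~ T) + K) != v (~~ T) (zs (~~ T)).
  apply/eqP => /(same (a := p)); move: (zi (~~ T)) (lK (~~ T)) K_gt1; clear.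
  by case: (e (~~ T)) => zt lK K_gt1 [|| _]; arith.
have p1 := lpath1 G1B w1 z1 (nW _ _ wcW).
have p2 : lpath B 2 wc (v (~~ T) (p (~~ T) + K)) (G1 :|: G2).
  exact: (lpath_ext p1 G2B z2 c2).
apply: (start_frame p2 FB) => //.
- by move=> z zF; rewrite in_setU => /orP[/(m13 z zF)|/(m23 z zF)].
- move=> z; rewrite !in_setU => /orP[/orP[]|].
  + by apply: (within_range (or_introl d1)); range_tac zt zf.
  + by apply: (within_range (or_intror d2)); range_tac zt zf.
  by apply: (within_range (or_intror d3)); range_tac zt zf.
rewrite in_setU; apply/negP => /orP[/(m13 _ n3)//|/(m23 _ n3)/eqP].
by rewrite (negPf (v_neq T _ _)).
Qed.

(** One more edge at the beginning: the edge of the other cycle on the opposite side,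
    which contains wc and meets the next one at the centre on T. *)
Lemma start_even : contains_copy (@loose_cycle K.+1 (3 + r.*2).+3) B.
Proof.
have [w0W zi cross] := sp; have zt := zi true; have zf := zi false.
have swc : [set wc] \subset W :\ w0 by rewrite sub1set in_setD1 wc0 wcW.
have swW : [set wc] \subset W by rewrite sub1set.
have [//||G0 [G0B _ c0 _ [w1 d0]]] :=
  cross (~~ T) (~~ e (~~ T)) false false _ _ swc; first by rewrite cards1.
have [//||G1 [G1B _ c1 [/(_ isT) z1 _] [_ d1]]] :=
  cross (~~ T) (e (~~ T)) true false set0 _ (sub0set _); first by rewrite cards0.
have [//||G2 [G2B _ c2 [_ /(_ isT) z2] [_ d2]]] :=
  cross T false false true set0 _ (sub0set _); first by rewrite cards0.
have [//||F [FB n3 c3 _ [_ d3]]] :=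
  cross T true false false set0 _ (sub0set _); first by rewrite cards0.
rewrite !sub1set negbK /= in c0 c1 n3 w1.
have m01 z : z \in G1 -> z \in G0 -> z = v T (p T + K).
  by move: z; apply: (within_meet (p := p) d1 d0); meet_tac3 zt zf.
have m02 z : z \in G2 -> z \in G0 -> False.
  by move: z; apply: (within_meet (p := p) d2 d0); meet_tac3 zt zf.
have m03 z : z \in F -> z \in G0 -> False.
  by move: z; apply: (within_meet (p := p) d3 d0); meet_tac3 zt zf.
have m12 z : z \in G2 -> z \in G1 -> z = v (~~ T) (zs (~~ T)).
  by move: z; apply: (within_meet (p := p) d2 d1); meet_tac3 zt zf.
have m13 z : z \in F -> z \in G1 -> False.
  by move: z; apply: (within_meet (p := p) d3 d1); meet_tac3 zt zf.
have m23 z : z \in F -> z \in G2 -> z = v (~~ T) (p (~~ T) + K).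
  by move: z; apply: (within_meet (p := p) d3 d2); meet_tac3 zt zf.
have zc : v (~~ T) (p (~~ T) + K) != v (~~ T) (zs (~~ T)).
  apply/eqP => /(same (a := p)); move: (zi (~~ T)) (lK (~~ T)) K_gt1; clear.
  by case: (e (~~ T)) => zt lK K_gt1 [|| _]; arith.
have p1 := lpath1 G0B w1 c0 (nW _ _ wcW).
have p2 : lpath B 2 wc (v (~~ T) (zs (~~ T))) (G0 :|: G1).
  by apply: (lpath_ext p1 G1B c1 z1) => //; rewrite eq_sym; apply: v_neq.
have p3 : lpath B 3 wc (v (~~ T) (p (~~ T) + K)) (G0 :|: G1 :|: G2).
  apply: (lpath_ext p2 G2B z2 c2) => // z zG.
  by rewrite in_setU => /orP[/(m02 z zG)|/(m12 z zG)].
apply: (start_frame p3 FB) => //.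
- by move=> z zF; rewrite !in_setU => /orP[/orP[/(m03 z zF)|/(m13 z zF)]|/(m23 z zF)].
- move=> z; rewrite !in_setU => /orP[/orP[/orP[]|]|].
  + by apply: (within_range (or_introl d0)); range_tac zt zf.
  + by apply: (within_range (or_intror d1)); range_tac zt zf.
  + by apply: (within_range (or_intror d2)); range_tac zt zf.
  by apply: (within_range (or_intror d3)); range_tac zt zf.
rewrite !in_setU; apply/negP => /orP[/orP[/(m03 _ n3)|/(m13 _ n3)]//|/(m23 _ n3)/eqP].
by rewrite (negPf (v_neq T _ _)).
Qed.

End Exceptional.

End Frame.

(** * A blue cycle of length m *)
Variable m : nat.
Hypotheses (m_gt2 : 2 < m) (lent : len true = m) (lenf : m < len false).
Hypothesis cardW : #|W| = (m - 1) %/ 2.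

Let class c : (forall T, 0 < c T) -> full true c \/ full false c \/ exists w0, exceptional w0 c :=
  @classification c.

Lemma full_or_exceptional c : (forall T, 0 < c T) ->
  (exists T, full T c) \/ exists w0, exceptional w0 c.
Proof.
by move=> /class[f|[f|]]; [left; exists true|left; exists false|right].
Qed.

Lemma full_usable T c w : full T c -> usable w c.
Proof. by case: T => f; [left|right; left]. Qed.

(** The vertex wc which closes the chain must differ from w0 and from the exceptional
    vertex, if any, of the last centre.  This is possible when |W| > 2.  If |W| = 2,
    there is a single slot after the start, and wc fails only if the two vertices of
    W are the exceptional vertices of two consecutive centres. *)
Lemma blue_exceptional w0 c : (forall T, 0 < c T) -> exceptional w0 c ->
  contains_copy (@loose_cycle K.+1 m) B.
Proof.
move=> c_gt0 sc.
pose p T := (c T).-1 * K.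
have [e [zs sp]] := exceptional_frame c_gt0 (p := p) (fun=> erefl) sc.
have [m3|m_gt3] := leqP m 3.
  have -> : m = 3 by arith.
  exact: (blue3 sp).
have [m4|m_gt4] := leqP m 4.
  have -> : m = 4 by arith.
  exact: (blue4 sp).
pose r := (m - 5) %/ 2; pose b T := (c T).+1.
have lenm T : m <= len T by case: T; rewrite ?lent // ltnW.
have w0W : w0 \in W by case: sc.
have ctr_gt0 j T : 0 < centre (front b j) T by [].
have okp j : exists X : {set V}, #|X| <= 1 /\
    forall w, w \in W -> w \notin X -> usable w (centre (front b j)).
  have [[T f]|[w1 s1]] := full_or_exceptional (ctr_gt0 j).
    by exists set0; rewrite cards0; split => // w _ _; apply: full_usable f.
  exists [set w1]; rewrite cards1; split => // w _; rewrite inE => ww1.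
  by right; right; exists w1; split => //; apply/eqP; rewrite eq_sym.
have natp : exists T (X : {set V}), #|X| <= 1 /\
    forall w, w \in W -> w \notin X -> slot_avail T (centre b) set0 w.
  have [[T f]|[w1 s1]] := full_or_exceptional (c := centre b) (fun=> isT).
    by exists T, set0; rewrite cards0; split => // w wW _; apply: full_slot.
  exists true, [set w1]; rewrite cards1; split => // w wW; rewrite inE => ww1.
  by apply: (exceptional_slot _ s1) => //; apply/eqP; rewrite eq_sym.
have fin T (X : {set V}) wc : wc \in W -> wc != w0 -> usable wc (centre (front b r)) -> #|X| <= 1 ->
    (r = 0 -> wc \notin X) ->
    (forall w, w \in W -> w \notin X -> slot_avail T (centre b) set0 w) ->
    contains_copy (@loose_cycle K.+1 m) B.
  move=> wcW wc0 okr X1 rX avX.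
  have bK T' : b T' * K = p T' + 2 * K.
    by rewrite /b /p; have := prednK (c_gt0 T'); move: (c T').-1 => q <-; arith.
  have len_r T' : r.*2 + 4 < len T' by have := lenm T'; rewrite /r; arith.
  have cW : 0 < r -> r + 1 < #|W| by rewrite cardW /r; arith.
  have nat_T : exists X : {set V}, [/\ #|X| <= 1, (r = 0 -> wc \notin X) &
    forall w, w \in W -> w \notin X -> slot_avail T (centre b) set0 w] by exists X.
  have [om|em] := boolP (odd m).
    have -> : m = (2 + r.*2).+3 by rewrite /r; arith.
    exact: (start_odd sp wcW wc0 bK len_r cW
      (fun j _ => okp j) okr nat_T).
  have -> : m = (3 + r.*2).+3 by rewrite /r; arith.
  exact: (start_even sp wcW wc0 bK len_r cW
      (fun j _ => okp j) okr nat_T).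
have cW : #|W| = r.+2 by rewrite cardW /r; arith.
have gt_b T : 0 < centre b T by [].
have [r0|r_gt0] := posnP r; last first.
  have [T [X [X1 avX]]] := natp; have [Z [Z1 okZ]] := okp r.
  have : 0 < #|W :\ w0 :\: Z|.
    have := cardsD1 w0 W; rewrite w0W cW => cw0.
    by have := subset_leq_card (subsetIr (W :\ w0) Z); rewrite (cardsD (W :\ w0) Z); arith.
  case/card_gt0P=> wc; rewrite in_setD in_setD1 => /and3P[wcZ wc0 wcW].
  by apply: (fin T X wc) => //; [apply: okZ|move=> r0; rewrite r0 in r_gt0].
have /card_gt0P[wc] : 0 < #|W :\ w0|.
  by have := cardsD1 w0 W; rewrite w0W cW; arith.
rewrite in_setD1 => /andP[wc0 wcW].
have okf : usable wc (centre b) -> usable wc (centre (front b r)) by rewrite r0.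
have [[T f]|[w1 s1]] := full_or_exceptional gt_b.
  apply: (fin T set0 wc) => //; rewrite ?cards0 ?inE //.
    by apply: okf; apply: full_usable f.
  by move=> w wW _; apply: full_slot.
have [ww1|ww1] := eqVneq wc w1; last first.
  apply: (fin true [set w1] wc) => //; rewrite ?cards1 ?inE //.
    by apply: okf; right; right; exists w1; split => //; apply/eqP; rewrite eq_sym.
  move=> w wW; rewrite inE => ww1'.
  by apply: (exceptional_slot _ s1) => //; apply/eqP; rewrite eq_sym.
have pE T : (centre b T).-1 * K = p T + 2 * K.
  by rewrite /b /p /centre /=; have := prednK (c_gt0 T); move: (c T).-1 => q <-; arith.
have [e' [zs' sp']] := exceptional_frame gt_b pE s1.
have w01 : w0 != w1 by rewrite -ww1 eq_sym.
have len4 T : 4 < len T by apply: leq_trans (lenm T).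
have [b5 b6] := blue5_blue6 sp sp' w01 len4.
have [om|em] := boolP (odd m).
  by have -> : m = 5 by move: r0; rewrite /r; arith.
by have -> : m = 6 by move: r0; rewrite /r; arith.
Qed.

Lemma blue_cycle : contains_copy (@loose_cycle K.+1 m) B.
Proof.
have [//|no] := contains_copy_dec (@loose_cycle K.+1 m) B.
have reg c : (forall T, 0 < c T) -> full true c \/ full false c.
  move=> c_gt0; have [f|[f|[w0 s]]] := class c_gt0; [by left|by right|].
  by case: no; apply: (blue_exceptional c_gt0 s).
have [om|em] := boolP (odd m); first exact: blue_odd.
apply: (blue_even reg) => //.
by rewrite ltn_neqAle m_gt2 andbT; apply: contra em => /eqP <-.
Qed.

End TwoRedCycles.

(** * Ramsey numbers *)

(** The red copy can be found inside any prescribed set of sufficient size. *)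
Lemma arrows_sub (k M N : nat) (V W : finType) (G : hypergraph V) (H : hypergraph W)
    (A : {set 'I_N}) (c : {set 'I_N} -> bool) :
  arrows k M G H -> M <= #|A| ->
  (exists f : V -> 'I_N, [/\ injective f, forall x, f x \in A &
     forall e, e \in G -> f @: e \in red_part k c]) \/
  contains_copy H (blue_part k c).
Proof.
move=> arr MA.
pose g (i : 'I_M) : 'I_N := enum_val (widen_ord MA i).
have g_inj : injective g by move=> i j /enum_val_inj/(congr1 val)/= /val_inj.
have gA i : g i \in A by apply: enum_valP.
have [[f [fi fe]]|[f [fi fe]]] := arr (fun e => c (g @: e)); [left|right];
  exists (fun x => g (f x)).
  split=> [x y /g_inj/fi //|x|e /fe]; first exact: gA.
  by rewrite (imset_comp g f) !inE (card_imset _ g_inj).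
split=> [x y /g_inj/fi //|e /fe].
by rewrite (imset_comp g f) !inE (card_imset _ g_inj).
Qed.

(** Off the red cycle of length m there remain (k-1)b + (m-1)/2 vertices, exactly what
    is needed for a red cycle of length b. *)
Lemma arrows_step (k m b : nat) : 3 < k -> 2 < m -> m < b ->
  arrows k ((k - 1) * m + (m - 1) %/ 2) (@loose_cycle k m) (@loose_cycle k m) ->
  arrows k ((k - 1) * b + (m - 1) %/ 2) (@loose_cycle k b) (@loose_cycle k m) ->
  arrows k ((k - 1) * (m + b) + (m - 1) %/ 2) (@loose_cycle k (m + b)) (@loose_cycle k m).
Proof.
case: k => [//|K] K_gt2 m_gt2 mb arrm arrb c.
have k_gt1 : 1 < K.+1 by lia.
set N := (_ + _)%N in c *; set f := (m - 1) %/ 2 in arrm arrb N c *.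
have NE : N = K * m + K * b + f by rewrite /N mulnDr subn1.
set R := red_part _ c; set B := blue_part _ c.
have [Rc|nRc] := contains_copy_dec (@loose_cycle K.+1 (m + b)) R; [by left|right].
have [|[f1 [f1i _ f1e]]|//] := arrows_sub (A := [set: 'I_N]) c arrm.
  by rewrite cardsT card_ord subn1 /=; move: NE; clearbody N f; lia.
pose A1 := [set f1 x | x : 'I_(m * (K.+1 - 1))].
have cA1 : #|A1| = K * m by rewrite card_imset // card_ord subn1 mulnC.
have [|[f2 [f2i f2A f2e]]|//] := arrows_sub (A := ~: A1) c arrb.
  rewrite subn1 /=; have := cardsC A1; rewrite cA1 card_ord; move: NE (#|~: A1|) => NE q; rewrite NE; lia.
pose A2 := [set f2 x | x : 'I_(b * (K.+1 - 1))].
have cA2 : #|A2| = K * b by rewrite card_imset // card_ord subn1 mulnC.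
have A12 : [disjoint A1 & A2].
  by rewrite disjoint_sym disjoints_subset; apply/subsetP => _ /imsetP[x _ ->].
pose W := ~: (A1 :|: A2).
have cW : #|W| = f.
  have := cardsC (A1 :|: A2); rewrite -/W cardsU (disjoint_setI0 A12) cards0 cA1 cA2.
  by rewrite card_ord; move: NE; clearbody N f; lia.
have [|v1 [v1E v1e v1A]] := loose_cycle_walk _ k_gt1 f1i f1e; first by lia.
have [|v2 [v2E v2e v2A]] := loose_cycle_walk _ k_gt1 f2i f2e; first by lia.
rewrite subn1 /= in v1E v1e v2E v2e.
pose v (T : bool) := if T then v1 else v2; pose len (T : bool) := if T then m else b.
have vE T s s' : v T s = v T s' <-> s = s' %[mod len T * K] by case: T.
have v12 s s' : v1 s != v2 s'.
  by apply: contraTneq (v1A s) => ->; rewrite (disjointFl A12 (v2A s')).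
have v_neq T s s' : v T s != v (~~ T) s' by case: T; rewrite //= eq_sym.
have vW T s : v T s \notin W.
  by rewrite in_setC negbK in_setU; case: T; rewrite ?v1A ?v2A ?orbT.
have len_gt2 T : 2 < len T by case: T => //=; lia.
have vR T i : seg (v T) (i * K) (i.+1 * K).+1 \in R by case: T.
have Runi : uniform K.+1 R by move=> e; rewrite !inE => /andP[/eqP].
have Buni : uniform K.+1 B by move=> e; rewrite !inE => /andP[/eqP].
have bmerge T d e (a : bool -> nat) (S Q : {set 'I_N}) : (forall T, 0 < a T) ->
  S \subset inner K v T d (a T) :|: inner K v (~~ T) e (a (~~ T)) :|: W ->
  Q \subset inner K v T d (a T) :|: inner K v (~~ T) e (a (~~ T)) :|: W ->
  [disjoint S & Q] -> #|S| = K - 1 -> #|Q| = K - 1 ->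
  (cross K v T d a S \in B) || (cross K v (~~ T) e a Q \in B).
  move=> a_gt0 sS sQ SQ cS cQ; rewrite -[_ || _]negbK negb_or; apply/negP.
  have cE1 : #|cross K v T d a S| = K.+1.
    exact: (card_cross K_gt2 vE v_neq vW len_gt2 sS (a_gt0 _) (a_gt0 _) cS).
  have sQ' : Q \subset inner K v (~~ T) e (a (~~ T)) :|: inner K v (~~ ~~ T) d (a (~~ ~~ T)) :|: W.
    by rewrite negbK (setUC (inner K v (~~ T) _ _)).
  have cE2 : #|cross K v (~~ T) e a Q| = K.+1.
    exact: (card_cross K_gt2 vE v_neq vW len_gt2 sQ' (a_gt0 _) (a_gt0 _) cQ).
  rewrite !inE cE1 cE2 eqxx /= !negbK => /andP[c1 c2]; apply: nRc.
  have := @merge_cycles _ K v len W K_gt2 vE v_neq vW len_gt2 R vR Runi T d e a S Q a_gt0 sS sQ SQ.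
  rewrite !inE cE1 cE2 eqxx c1 c2 => /(_ isT isT).
  by case: (T); rewrite //= addnC.
exact: (@blue_cycle _ K v len W B K_gt2 vE v_neq vW len_gt2 Buni bmerge m).
Qed.

Lemma card_ord_interval (M t d : nat) (A : {set 'I_M}) :
  (forall x, x \in A -> t <= x < t + d) -> #|A| <= d.
Proof.
move=> Ad; rewrite cardE -(size_map val) -(size_iota t d).
apply: uniq_leq_size; first by rewrite (map_inj_uniq val_inj) enum_uniq.
by move=> x /mapP[y]; rewrite mem_enum => /Ad yA ->; rewrite mem_iota.
Qed.

(** The edges inside A, the set of the first (k-1)n-1 vertices, are red; if M were
    smaller than claimed, at most (m-1)/2 vertices would be outside A. *)
Lemma arrows_lower (k m n M : nat) : 1 < k -> 0 < m -> 0 < n ->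
  arrows k M (@loose_cycle k n) (@loose_cycle k m) -> (k - 1) * n + (m - 1) %/ 2 <= M.
Proof.
move=> k_gt1 m_gt0 n_gt0 arr; rewrite leqNgt; apply/negP => ltM.
have kn : 0 < (k - 1) * n by rewrite muln_gt0 n_gt0 andbT; lia.
pose t := (k - 1) * n - 1; pose A := [set x : 'I_M | x < t].
have [[f [fi fe]]|[f [fi fe]]] := arr (fun e => e \subset A).
  have fA x : f x \in A.
    have x_lt := ltn_ord x.
    have ilt : x %/ (k - 1) < n by rewrite ltn_divLR //; lia.
    have jlt : x %% (k - 1) < k by have := @ltn_pmod x (k - 1); lia.
    have sA : f @: loose_edge k (Ordinal ilt) \subset A.
      have /fe : loose_edge k (Ordinal ilt) \in loose_cycle k n by apply: imset_f.
      by rewrite !inE => /andP[].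
    apply: (subsetP sA); apply: imset_f.
    rewrite inE; apply/existsP; exists (Ordinal jlt) => /=.
    by rewrite -divn_eq modn_small.
  have : #|[set f x | x : 'I_(n * (k - 1))]| <= #|A|.
    by apply: subset_leq_card; apply/subsetP => _ /imsetP[x _ ->].
  rewrite card_imset // card_ord => h.
  have hA : #|A| <= t by apply: (@card_ord_interval _ 0) => x; rewrite inE.
  by move: (leq_trans h hA); rewrite /t mulnC; lia.
pose P := [set x | f x \notin A].
have cP : #|P| <= (m - 1) %/ 2.
  rewrite -(card_imset _ fi); apply: (@card_ord_interval _ t) => y /imsetP[x].
  rewrite !inE -leqNgt => tx ->; rewrite tx /=.
  by have := ltn_ord (f x); move: kn ltM; rewrite /t; lia.
have hit i : exists x, (x \in loose_edge k i) && (x \in P).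
  have /fe : loose_edge k i \in loose_cycle k m by apply: imset_f.
  rewrite !inE => /andP[_ /subsetPn[_ /imsetP[x xi ->] xA]].
  by exists x; rewrite xi inE.
pose h i := xchoose (hit i).
have hP i : (h i \in loose_edge k i) && (h i \in P) by apply: (xchooseP (hit i)).
(* A vertex lies on at most two edges, the one whose number is its quotient by k-1
   and possibly the preceding one: the boolean tells them apart. *)
pose g i := (h i, h i %/ (k - 1) == i).
have k1 : 0 < k - 1 by lia.
have g_inj : injective g.
  have hE i : h i %/ (k - 1) = i \/ h i %/ (k - 1) = i.+1 %% m.
    have /andP[+ _] := hP i; rewrite inE => /existsP[j /eqP ->].
    have [jk|jk] := ltnP j (k - 1).
      left; rewrite modn_small; first by rewrite divnMDl // divn_small ?addn0.
      by have := ltn_ord i; nia.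
    right; have -> : i * (k - 1) + j = i.+1 * (k - 1) by have := ltn_ord j; nia.
    by rewrite -muln_modl mulnK.
  move=> i j [hij]; have := hE j; have := hE i; rewrite hij.
  set q := _ %/ _; have [-> _ _ /esym/eqP/val_inj //|qi] := eqVneq q i.
  case=> [/eqP|E1]; first by rewrite (negPf qi).
  case=> [/eqP|E2]; first by move=> /eqP -> /esym; rewrite eqxx.
  move=> _; apply: val_inj => /=; move: E2; rewrite E1 -(addn1 i) -(addn1 j) => /eqP.
  by rewrite eqn_modDr !modn_small // => /eqP.
have : #|[set g i | i : 'I_m]| <= #|setX P [set: bool]|.
  apply: subset_leq_card; apply/subsetP => _ /imsetP[i _ ->].
  by rewrite in_setX in_setT andbT; case/andP: (hP i).
by rewrite card_imset // card_ord cardsX cardsT card_bool; lia.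
Qed.

Theorem theorem3p2 (m k : nat) (hm : 3 <= m) (hk : 4 <= k)
    (hA : forall n : nat, m <= n <= 2 * m -> A k m n) :
  forall n : nat, A k m n <-> m <= n.
Proof.
have arr n : m <= n -> arrows k ((k - 1) * n + (m - 1) %/ 2)
    (@loose_cycle k n) (@loose_cycle k m).
  elim/ltn_ind: n => n IH mn.
  have [n2|n2] := leqP n (2 * m).
    by have [|_ []] := hA n; first by rewrite mn.
  have -> : n = m + (n - m) by lia.
  by apply: arrows_step => //; [lia|apply: IH; lia|apply: IH; lia].
move=> n; split=> [[]//|mn]; split => //; split; first exact: arr.
by move=> M; apply: arrows_lower; lia.
Qed.
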